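(* Let $(\overline{M},\overline{\nabla},g,J)$ be a holomorphic statistical manifold of real dimension $2m$ and let $M$ be a doubly autoparallel holomorphic submanifold of $\overline{M}$ of real dimension $2n$. If the statistical Bochner curvature tensor of $\overline{M}$ vanishes identically, then the statistical Bochner curvature tensor of $M$ (with its induced holomorphic statistical structure) also vanishes identically.
   Context: All manifolds, metrics and connections are smooth. Statistical manifold: a manifold $N$ with a Riemannian metric $g$ and a torsion-free affine connection $\nabla$ such that the $(0,3)$-tensor field $\nabla g$ is totally symmetric. The dual connection $\nabla^*$ is defined by $Xg(Y,Z)=g(\nabla_XY,Z)+g(Y,\nabla^*_XZ)$; it is also torsion-free. Statistical curvature: with $\mathcal{R}(X,Y)Z=\nabla_X\nabla_YZ-\nabla_Y\nabla_XZ-\nabla_{[X,Y]}Z$ and $\mathcal{R}^*$ the same expression for $\nabla^*$, set $\mathcal{S}(X,Y)Z=\frac12[\mathcal{R}(X,Y)Z+\mathcal{R}^*(X,Y)Z]$. The statistical Ricci curvature is $\mathcal{L}(Y,Z)=\operatorname{tr}\{X\mapsto \mathcal{S}(X,Y)Z\}$; the same letter denotes the $(1,1)$-tensor given by $g(\mathcal{L}Y,Z)=\mathcal{L}(Y,Z)$. The statistical scalar curvature is $\rho=\operatorname{tr}_g\mathcal{L}$. Holomorphic statistical manifold $(N,\nabla,g,J)$: an almost complex manifold with almost complex structure $J$ and a statistical structure $(\nabla,g)$ such that $\omega(X,Y)=g(X,JY)$ is a $\nabla$-parallel 2-form (so $g$ is $J$-Hermitian). Statistical Bochner curvature tensor of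 a holomorphic statistical manifold of real dimension $2k$: $$\begin{aligned}\mathcal{B}(X,Y)Z=\;&\mathcal{S}(X,Y)Z-\tfrac{1}{2k+4}\{g(Y,Z)\mathcal{L}X-g(\mathcal{L}X,Z)Y+g(\mathcal{L}Y,Z)X-g(X,Z)\mathcal{L}Y\\&+g(JY,Z)\mathcal{L}JX-g(\mathcal{L}JX,Z)JY+g(\mathcal{L}JY,Z)JX-g(JX,Z)\mathcal{L}JY\\&-2g(JX,\mathcal{L}Y)JZ-2g(JX,Y)\mathcal{L}JZ\}\\&+\tfrac{\rho}{(2k+4)(2k+2)}\{g(Y,Z)X-g(X,Z)Y+g(JY,Z)JX-g(JX,Z)JY-2g(JX,Y)JZ\}.\end{aligned}$$ For $\overline{M}$ one takes $k=m$ and the curvature quantities of $(\overline{\nabla},g)$; for $M$ one takes $k=n$ and the curvature quantities of the induced statistical structure. Submanifolds: let $M$ be an isometrically immersed submanifold of $\overline{M}$ with induced metric $g$. For $X,Y$ tangent to $M$ decompose into tangential and normal parts $\overline{\nabla}_XY=\nabla_XY+h(X,Y)$ and $\overline{\nabla}^*_XY=\nabla^*_XY+h^*(X,Y)$. Then $(\nabla,g)$ is the induced statistical structure on $M$, with dual connection $\nabla^*$. $M$ is doubly autoparallel if $h=0$ and $h^*=0$. $M$ is a holomorphic submanifold if $J(T_xM)=T_xM$ for all $x\in M$; then $(M,\nabla,g,J|_{TM})$ is itself a holomorphic statistical manifold. *)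

(* Defs.v *)
From HB Require Import structures.
From mathcomp Require Import all_boot all_order all_algebra.
From mathcomp Require Import all_classical all_reals.
From mathcomp Require Import topology normedtype derive.

Set Implicit Arguments.
Unset Strict Implicit.
Unset Printing Implicit Defensive.

Import Order.TTheory GRing.Theory Num.Theory numFieldNormedType.Exports.
Local Open Scope classical_set_scope.
Local Open Scope ring_scope.

Section SmoothFunctions.
Context {R : realType} {V W : normedModType R}.

Fixpoint Ck (k : nat) (U : set V) (f : V -> W) : Prop :=
  match k with
  | 0%N => forall x, U x -> {for x, continuous f}
  | k'.+1 => (forall x, U x -> differentiable f x) /\
             (forall v, Ck k' U (fun x => 'D_v f x))
  end.

Definition smooth_on (U : set V) (f : V -> W) := forall k, Ck k U f.

Definition smooth_near (f : V -> W) (x : V) :=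
  exists2 U, open_nbhs x U & smooth_on U f.

End SmoothFunctions.

(* A smooth d-manifold without boundary.  The smooth structure is generated by
   an atlas [{chart p}] indexed by the points, [chart p] being a chart around
   [p]; any smooth structure has such an atlas.  [chart p] and [chart_inv p]
   are total functions that are meaningful only on [dom p] and its image. *)
Record manifold (R : realType) (d : nat) := Manifold {
  point :> topologicalType;
  manifold_hausdorff : hausdorff_space point;
  manifold_countable : @second_countable point;
  dom : point -> set point;
  chart : point -> point -> 'rV[R]_d;
  chart_inv : point -> 'rV[R]_d -> point;
  dom_open : forall p, open (dom p);
  dom_mem : forall p, dom p p;
  codom_open : forall p, open (chart p @` dom p);
  chartK : forall p q, dom p q -> chart_inv p (chart p q) = q;
  chart_continuous : forall p q, dom p q -> {for q, continuous (chart p)};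
  chart_inv_continuous : forall p x, (chart p @` dom p) x ->
    {for x, continuous (chart_inv p)};
  transition_smooth : forall p q,
    smooth_on (chart p @` (dom p `&` dom q)) (chart q \o chart_inv p) }.

Arguments dom {R d m}.
Arguments chart {R d m}.
Arguments chart_inv {R d m}.

(* The tangent space at [p] is 'rV[R]_d: a vector is given by its components in
   the chart [chart p].  Since [chart q] varies with [q] in no continuous way,
   the fields below are always differentiated after a change to a fixed chart
   ([transfer], [localrep]). *)
Section Manifold.
Context {R : realType} {d : nat} (M : manifold R d).
Implicit Types (p q r : M) (u v w : 'rV[R]_d).

Definition vfield := M -> 'rV[R]_d.
Implicit Types X Y Z : vfield.

(* components in [chart q] of the vector of T_r M whose components in
   [chart p] are v *)
Definition transfer p q r v : 'rV[R]_d :=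
  'D_v (chart q \o chart_inv p) (chart p r).

Definition localrep p X (x : 'rV[R]_d) : 'rV[R]_d :=
  let r := chart_inv p x in transfer r p r (X r).

(* the vector field with constant components u in [chart p] (relevant on
   [dom p] only) *)
Definition coord_field p u : vfield := fun r => transfer p r r u.

Definition smooth_fun_at p (h : M -> R) :=
  smooth_near (h \o chart_inv p) (chart p p).

Definition smooth_field_at p X := smooth_near (localrep p X) (chart p p).

Definition dirder p v (h : M -> R) : R := 'D_v (h \o chart_inv p) (chart p p).

Definition bracket X Y : vfield := fun p =>
  'D_(X p) (localrep p Y) (chart p p) - 'D_(Y p) (localrep p X) (chart p p).

Record metric := Metric {
  metric_fun :> M -> 'rV[R]_d -> 'rV[R]_d -> R;
  metric_linear : forall p a u v w,
    metric_fun p (a *: u + v) w = a * metric_fun p u w + metric_fun p v w;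
  metric_sym : forall p u v, metric_fun p u v = metric_fun p v u;
  metric_gt0 : forall p u, u != 0 -> 0 < metric_fun p u u;
  metric_smooth : forall p X Y, smooth_field_at p X -> smooth_field_at p Y ->
    smooth_fun_at p (fun q => metric_fun q (X q) (Y q)) }.

(* [cov p v Y] is the covariant derivative at [p], in the direction of the
   tangent vector [v], of a vector field [Y] that is smooth near [p]; no
   condition is put on the values at other fields.  As the axioms hold for all
   functions and fields that are smooth near [p] (e.g. indicator functions of
   neighbourhoods of [p]), they imply that [cov p v Y] depends only on the germ
   of [Y] at [p]. *)
Record connection := Connection {
  cov :> M -> 'rV[R]_d -> vfield -> 'rV[R]_d;
  cov_linear : forall p a u v Y, smooth_field_at p Y ->
    cov p (a *: u + v) Y = a *: cov p u Y + cov p v Y;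
  cov_add : forall p v Y Z, smooth_field_at p Y -> smooth_field_at p Z ->
    cov p v (fun q => Y q + Z q) = cov p v Y + cov p v Z;
  cov_leibniz : forall p v h Y, smooth_fun_at p h -> smooth_field_at p Y ->
    cov p v (fun q => h q *: Y q) = dirder p v h *: Y p + h p *: cov p v Y;
  cov_smooth : forall p X Y, smooth_field_at p X -> smooth_field_at p Y ->
    smooth_field_at p (fun q => cov q (X q) Y) }.

Record almost_complex := AlmostComplex {
  complex_fun :> M -> 'rV[R]_d -> 'rV[R]_d;
  complex_linear : forall p a u v,
    complex_fun p (a *: u + v) = a *: complex_fun p u + complex_fun p v;
  complex_square : forall p u, complex_fun p (complex_fun p u) = - u;
  complex_smooth : forall p X, smooth_field_at p X ->
    smooth_field_at p (fun q => complex_fun q (X q)) }.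

Section Structures.
Variables (g : metric) (nabla nablas : connection) (J : almost_complex).

Definition nab (D : connection) X Y : vfield := fun p => D p (X p) Y.

Definition torsion_free := forall p X Y,
  smooth_field_at p X -> smooth_field_at p Y ->
  nab nabla X Y p - nab nabla Y X p = bracket X Y p.

(* (nabla_X b)(Y, Z) at p, for a (0,2)-tensor field b *)
Definition nabla_tensor (b : M -> 'rV[R]_d -> 'rV[R]_d -> R) X Y Z p : R :=
  dirder p (X p) (fun q => b q (Y q) (Z q))
  - b p (nab nabla X Y p) (Z p) - b p (Y p) (nab nabla X Z p).

Definition statistical :=
  torsion_free /\
  forall p X Y Z,
    smooth_field_at p X -> smooth_field_at p Y -> smooth_field_at p Z ->
    nabla_tensor g X Y Z p = nabla_tensor g Y X Z p /\
    nabla_tensor g X Y Z p = nabla_tensor g X Z Y p.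

Definition dual_connections := forall p X Y Z,
  smooth_field_at p X -> smooth_field_at p Y -> smooth_field_at p Z ->
  dirder p (X p) (fun q => g q (Y q) (Z q)) =
  g p (nab nabla X Y p) (Z p) + g p (Y p) (nab nablas X Z p).

Definition omega p u v : R := g p u (J p v).

Definition holomorphic_statistical :=
  [/\ statistical,
      forall p u v, omega p u v = - omega p v u &
      forall p X Y Z,
        smooth_field_at p X -> smooth_field_at p Y -> smooth_field_at p Z ->
        nabla_tensor omega X Y Z p = 0].

Definition curvature (D : connection) X Y Z : vfield := fun p =>
  nab D X (nab D Y Z) p - nab D Y (nab D X Z) p - nab D (bracket X Y) Z p.

Definition stat_curvature X Y Z : vfield := fun p =>
  2^-1 *: (curvature nabla X Y Z p + curvature nablas X Y Z p).

(* The value of the tensor S on tangent vectors at p; by tensoriality any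
   smooth extensions of u, v, w may be used. *)
Definition Scurv p u v w : 'rV[R]_d :=
  stat_curvature (coord_field p u) (coord_field p v) (coord_field p w) p.

Definition trace (T : 'rV[R]_d -> 'rV[R]_d) : R := \tr (lin1_mx T).

Definition ricci p v w : R := trace (fun u => Scurv p u v w).

Definition gram p : 'M[R]_d :=
  \matrix_(i, j) g p (delta_mx 0 i) (delta_mx 0 j).

(* the vector representing a linear form, see [sharpP] *)
Definition sharp p (a : 'rV[R]_d -> R) : 'rV[R]_d :=
  (\row_j a (delta_mx 0 j)) *m invmx (gram p).

Definition ricci_op p v : 'rV[R]_d := sharp p (ricci p v).

Definition scalar_curv p : R := trace (ricci_op p).

(* d is the real dimension, i.e. 2k in the usual notation *)
Definition bochner p (X Y Z : 'rV[R]_d) : 'rV[R]_d :=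
  let gp := g p in let Jp := J p in let L := ricci_op p in
  Scurv p X Y Z
  - ((d + 4)%:R)^-1 *:
    (gp Y Z *: L X - gp (L X) Z *: Y + gp (L Y) Z *: X - gp X Z *: L Y
     + gp (Jp Y) Z *: L (Jp X) - gp (L (Jp X)) Z *: Jp Y
     + gp (L (Jp Y)) Z *: Jp X - gp (Jp X) Z *: L (Jp Y)
     - (2 * gp (Jp X) (L Y)) *: Jp Z - (2 * gp (Jp X) Y) *: L (Jp Z))
  + (scalar_curv p / ((d + 4)%:R * (d + 2)%:R)) *:
    (gp Y Z *: X - gp X Z *: Y + gp (Jp Y) Z *: Jp X - gp (Jp X) Z *: Jp Y
     - (2 * gp (Jp X) Y) *: Jp Z).

Definition bochner_flat := forall p (X Y Z : 'rV[R]_d), bochner p X Y Z = 0.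

Lemma metricE p u v : g p u v = (u *m gram p *m v^T) 0 0.
Proof.
have lin w : linear_for *%R (fun x => g p x w).
  by move=> a x y; rewrite metric_linear.
have sumE w x : g p x w = \sum_i x 0 i * g p (delta_mx 0 i) w.
  pose h := GRing.isLinear.Build _ _ _ _ _ (lin w).
  pose G : {linear 'rV[R]_d -> R | *%R} := HB.pack (fun x => g p x w) h.
  rewrite -[LHS]/(G x) {1}[x]row_sum_delta linear_sum /=.
  by apply: eq_bigr => i _; rewrite -[LHS]/(G _) linearZ.
rewrite metric_sym sumE mxE; apply: eq_bigr => j _.
rewrite !mxE metric_sym sumE mulrC; congr (_ * _).
by apply: eq_bigr => i _; rewrite mxE.
Qed.

Lemma gram_unit p : gram p \in unitmx.
Proof.
rewrite -row_free_unit -kermx_eq0; apply/rowV0P => x /sub_kermxP xG0.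
apply/eqP; apply: contraT => /(metric_gt0 g p).
by rewrite metricE xG0 mul0mx mxE ltxx.
Qed.

Lemma sharpP p (a : {linear 'rV[R]_d -> R | *%R}) w : g p (sharp p a) w = a w.
Proof.
rewrite metricE /sharp mulmxKV ?gram_unit// mxE.
rewrite {2}[w]row_sum_delta linear_sum; apply: eq_bigr => i _.
by rewrite linearZ /= !mxE mulrC.
Qed.

End Structures.
End Manifold.

Section Submanifold.
Context {R : realType} {d e : nat} {M : manifold R d} {N : manifold R e}.
Variable f : M -> N.
Implicit Types (p : M) (u v : 'rV[R]_d) (w : 'rV[R]_e).

Definition map_rep p : 'rV[R]_d -> 'rV[R]_e :=
  chart (f p) \o f \o chart_inv p.

Definition tangent_map p v : 'rV[R]_e := 'D_v (map_rep p) (chart p p).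

Definition smooth_map :=
  continuous f /\ forall p, smooth_near (map_rep p) (chart p p).

Definition immersion := smooth_map /\ forall p, injective (tangent_map p).

Definition pushforward (X : vfield M) p : 'rV[R]_e := tangent_map p (X p).

(* Covariant derivative of a vector field [V] along [f], [V p] being a tangent
   vector of [N] at [f p].  In the chart around [f p] it is the usual
   (dV^c(v) + Gamma^c_ab (df v)^a V^b), the second term being the derivative
   of the field with constant components.  If V = Y \o f near p for a field
   [Y] of [N] smooth near [f p], it is the derivative of [Y] in the direction
   [tangent_map p v], so this is what the ambient connection gives for fields
   tangent to [M], however they are extended. *)
Definition cov_along (D : connection N) (V : M -> 'rV[R]_e) p v : 'rV[R]_e :=
  'D_v (fun x => let q := chart_inv p x in
                 transfer (f q) (f p) (f q) (V q)) (chart p p)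
  + D (f p) (tangent_map p v) (coord_field (f p) (V p)).

Definition isometric (gN : metric N) (g : metric M) := forall p u v,
  g p u v = gN (f p) (tangent_map p u) (tangent_map p v).

Definition normal (gN : metric N) p w := forall u,
  gN (f p) w (tangent_map p u) = 0.

(* the second fundamental form, when [D] is the tangential part of [DN] *)
Definition second_form (DN : connection N) (D : connection M)
    (X Y : vfield M) p : 'rV[R]_e :=
  cov_along DN (pushforward Y) p (X p) - tangent_map p (nab D X Y p).

Definition induced_connection (gN : metric N) (DN : connection N)
    (D : connection M) := forall p X Y,
  smooth_field_at p X -> smooth_field_at p Y ->
  normal gN p (second_form DN D X Y p).

Definition doubly_autoparallel (DN DNs : connection N) (D Ds : connection M) :=
  forall p X Y, smooth_field_at p X -> smooth_field_at p Y ->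
  second_form DN D X Y p = 0 /\ second_form DNs Ds X Y p = 0.

Definition holomorphic_submanifold (JN : almost_complex N) := forall p,
  JN (f p) @` range (tangent_map p) = range (tangent_map p).

Definition induced_complex (JN : almost_complex N) (J : almost_complex M) :=
  forall p u, tangent_map p (J p u) = JN (f p) (tangent_map p u).

End Submanifold.

(* Main.v *)
Require Import Defs.
From HB Require Import structures.
From mathcomp Require Import all_boot all_order all_algebra.
From mathcomp Require Import all_classical all_reals.
From mathcomp Require Import topology normedtype landau derive.
From mathcomp Require Import ring lra.

(** The proof has an analytic half, the Gauss equation of an autoparallel
submanifold, and a purely algebraic half.

Gauss equation.  Let F be the immersion f read in the charts around p and
f p, and write the connections through their Christoffel symbols GN and GM.
The vanishing of the second fundamental form says (gauss_formula) that

  D_u D_v F + GN(F)(D_u F, D_v F) = dF (GM(u, v))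

in a neighbourhood of p.  Differentiating once more, in a direction w, and
antisymmetrizing in u and w removes the third derivatives of F, and using the
same formula to remove the second ones leaves exactly
dF (R(w, u) v) = RN(dF w, dF u) (dF v) (gauss_riemann).  This applies to both
connections, hence to the statistical curvature (gauss_Scurv).

Algebra.  Let BB(Q) be the tensor that the Bochner formula builds from an
operator Q (bochner_brace) and H the curvature tensor of a complex space form
(holomorphic_brace), so that BB(id) = 2 H.  Bochner-flatness of the ambient
space means SN = c BB(L) - a H, where L is its Ricci operator.  Taking the
trace of this equation forces L to be symmetric and to commute with J
(bochner_flat_ricci).  On the submanifold let Q be the compression of L to the tangent space, that is,
g(Q u, v) = gN(L (df u), df v).  It is again symmetric and commutes with J,
and the Gauss equation gives S = c BB(Q) - a H.  Tracing once more, the Ricci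
operator of the submanifold is a combination of Q and the identity, and the
Bochner formula cancels every tensor of this shape (bochner_of_brace). *)

Set Implicit Arguments.
Unset Strict Implicit.
Unset Printing Implicit Defensive.

Import Order.TTheory GRing.Theory Num.Theory numFieldNormedType.Exports.
Local Open Scope classical_set_scope.
Local Open Scope ring_scope.

(** * Linear maps *)

Section LinearFunctions.
Variables (R : pzRingType) (U W : lmodType R) (phi : U -> W).
Hypothesis lphi : linear phi.

Lemma linD u v : phi (u + v) = phi u + phi v.
Proof. by have := lphi 1 u v; rewrite !scale1r. Qed.

Lemma lin0 : phi 0 = 0.
Proof.
have /eqP := linD 0 0.
by rewrite addr0 -subr_eq0 opprD addrA subrr sub0r oppr_eq0 => /eqP.
Qed.

Lemma linZ a u : phi (a *: u) = a *: phi u.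
Proof. by rewrite -[a *: u]addr0 lphi lin0 addr0. Qed.

Lemma linN u : phi (- u) = - phi u.
Proof. by rewrite -scaleN1r linZ scaleN1r. Qed.

Lemma linB u v : phi (u - v) = phi u - phi v.
Proof. by rewrite linD linN. Qed.

End LinearFunctions.

Lemma lin_comp (R : pzRingType) (U V W : lmodType R) (f : U -> V) (g : V -> W) :
  linear f -> linear g -> linear (fun x => g (f x)).
Proof. by move=> lf lg a u v; rewrite lf lg. Qed.

Lemma lin_add (R : comPzRingType) (U V : lmodType R) (f g : U -> V) :
  linear f -> linear g -> linear (fun x => f x + g x).
Proof. by move=> lf lg a u v; rewrite lf lg scalerDr addrACA. Qed.

Lemma lin_sub (R : comPzRingType) (U V : lmodType R) (f g : U -> V) :
  linear f -> linear g -> linear (fun x => f x - g x).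
Proof.
by move=> lf lg a u v; rewrite lf lg scalerBr opprD addrACA.
Qed.

Lemma lin_scale (R : comPzRingType) (U V : lmodType R) k (f : U -> V) :
  linear f -> linear (fun x => k *: f x).
Proof. by move=> lf a u v; rewrite lf scalerDr !scalerA mulrC. Qed.

Lemma linfam_sum (R : realType) n m (phi : 'rV[R]_n -> 'rV[R]_m) a :
  linear phi -> phi a = \sum_i a 0 i *: phi (delta_mx 0 i).
Proof.
move=> lphi.
pose h := GRing.isLinear.Build _ _ _ _ _ lphi.
pose G : {linear 'rV[R]_n -> 'rV[R]_m} := HB.pack phi h.
rewrite -[phi a]/(G a) {1}[a]row_sum_delta linear_sum.
by apply: eq_bigr => i _; rewrite linearZ.
Qed.

(** * Differentiation of sums, products and composites *)

Section Calculus.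
Context {R : realType} {V : normedModType R}.

(** A function that agrees with f near x has the same first order expansion
    at x, so the differential of f serves for it as well. *)
Lemma near_eq_differentiable {W : normedModType R} (f g : V -> W) x :
  (\forall y \near x, f y = g y) -> differentiable f x -> differentiable g x.
Proof.
move=> fg df.
have gE : g \o shift x = cst (g x) + 'd f x +o_ (0 : V) id.
  have fE := diff_locally df.
  apply/eqaddoP => e e0; have /eqaddoP/(_ e e0) := fE.
  have fgx := nbhs_singleton fg.
  have : \forall h \near (0 : V), f (h + x) = g (h + x).
    by move: fg; rewrite (near_shift 0 x) /=; apply: filterS => h; rewrite /= subr0.
  apply: filterS2 => h hfg.
  by rewrite /= /cst /= !fctE /= hfg fgx.
apply/diff_locallyP.
have [dfc _] := proj1 (diff_locallyP _ _) df.
have -> : 'd g x = 'd f x :> (V -> W) by exact: diff_unique.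
by split.
Qed.

Lemma differentiable_bigsum {W : normedModType R} I (s : seq I)
    (f : I -> V -> W) x :
  (forall i, differentiable (f i) x) ->
  differentiable (fun y => \sum_(i <- s) f i y) x.
Proof.
move=> df; elim: s => [|i s IH].
  by under eq_fun do rewrite big_nil; exact: differentiable_cst.
by under eq_fun do rewrite big_cons; exact: differentiableD.
Qed.

Lemma derive_bigsum {W : normedModType R} I (s : seq I) (f : I -> V -> W) x v :
  (forall i, differentiable (f i) x) ->
  'D_v (fun y => \sum_(i <- s) f i y) x = \sum_(i <- s) 'D_v (f i) x.
Proof.
move=> df; elim: s => [|i s IH].
  by under eq_fun do rewrite big_nil; rewrite big_nil derive_cst.
under eq_fun do rewrite big_cons.
rewrite big_cons -IH; apply: deriveD; apply: diff_derivable => //.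
exact: differentiable_bigsum.
Qed.

Lemma differentiable_rV n (f : V -> 'rV[R]_n) x :
  (forall i, differentiable (fun y => f y 0 i) x) -> differentiable f x.
Proof.
move=> df.
have -> : f = (fun y => \sum_i f y 0 i *: delta_mx 0 i).
  by apply/funext => y; rewrite -row_sum_delta.
by apply: differentiable_bigsum => i; exact: differentiableZl.
Qed.

Lemma differentiable_entry n (f : V -> 'rV[R]_n) x i :
  differentiable f x -> differentiable (fun y => f y 0 i) x.
Proof.
move=> df; apply: (@differentiable_comp _ _ _ _ f (fun N : 'rV[R]_n => N 0 i : R) x df).
exact: differentiable_coord.
Qed.

Lemma derive_entry n (f : V -> 'rV[R]_n) x v i : differentiable f x ->
  'D_v (fun y => f y 0 i) x = ('D_v f x) 0 i.
Proof. by move=> /diff_derivable df; rewrite derive_mx// mxE. Qed.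

Lemma differentiable_scale n (h : V -> R) (f : V -> 'rV[R]_n) x :
  differentiable h x -> differentiable f x ->
  differentiable (fun y => h y *: f y) x.
Proof.
move=> dh df; apply: differentiable_rV => i.
under eq_fun do rewrite mxE.
exact: (differentiableM dh (differentiable_entry i df)).
Qed.

Lemma derive_scale n (h : V -> R) (f : V -> 'rV[R]_n) x v :
  differentiable h x -> differentiable f x ->
  'D_v (fun y => h y *: f y) x = 'D_v h x *: f x + h x *: 'D_v f x.
Proof.
move=> dh df; apply/rowP => i.
rewrite -derive_entry; last exact: differentiable_scale.
under eq_fun do rewrite mxE.
have dfi := differentiable_entry i df.
rewrite (deriveM (diff_derivable dh) (diff_derivable dfi)) derive_entry// !mxE.
by rewrite addrC; congr (_ + _); exact: mulrC.
Qed.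

Lemma derive_addv {W : normedModType R} (f : V -> W) x a u v :
  differentiable f x -> 'D_(a *: u + v) f x = a *: 'D_u f x + 'D_v f x.
Proof. by move=> df; rewrite !deriveE// linearP. Qed.

Lemma derive_comp {U W : normedModType R} (h : V -> U) (g : U -> W) x v :
  differentiable h x -> differentiable g (h x) ->
  'D_v (g \o h) x = 'D_('D_v h x) g (h x).
Proof.
by move=> dh dg; rewrite !deriveE//; [rewrite diff_comp|exact: differentiable_comp].
Qed.


Lemma differentiable_linfam n m (phi : V -> 'rV[R]_n -> 'rV[R]_m)
    (a : V -> 'rV[R]_n) x :
  (\forall y \near x, linear (phi y)) ->
  (forall c, differentiable (phi ^~ c) x) -> differentiable a x ->
  differentiable (fun y => phi y (a y)) x.
Proof.
move=> lphi dphi da.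
apply: (@near_eq_differentiable _
  (fun y => \sum_i a y 0 i *: phi y (delta_mx 0 i))).
  by apply: filterS lphi => y ly; rewrite -linfam_sum.
apply: differentiable_bigsum => i.
exact: (@differentiable_scale _ (fun y => a y 0 i) (phi ^~ (delta_mx 0 i))
  _ (differentiable_entry i da) (dphi _)).
Qed.

(** A product rule, the product being the evaluation of a linear map at a
    vector.  Bilinear expressions such as Christoffel symbols evaluated on
    two moving vectors are differentiated by using it twice. *)
Lemma derive_linfam n m (phi : V -> 'rV[R]_n -> 'rV[R]_m)
    (a : V -> 'rV[R]_n) x v :
  (\forall y \near x, linear (phi y)) ->
  (forall c, differentiable (phi ^~ c) x) -> differentiable a x ->
  'D_v (fun y => phi y (a y)) x =
  'D_v (phi ^~ (a x)) x + phi x ('D_v a x).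
Proof.
move=> lphi dphi da.
have lx := nbhs_singleton lphi.
have expand (b : V -> 'rV[R]_n) : 'D_v (fun y => phi y (b y)) x =
    'D_v (fun y => \sum_i b y 0 i *: phi y (delta_mx 0 i)) x.
  by apply: near_eq_derive; apply: filterS lphi => y ly; rewrite -linfam_sum.
have dS (b : V -> 'rV[R]_n) : differentiable b x ->
    'D_v (fun y => \sum_i b y 0 i *: phi y (delta_mx 0 i)) x =
    \sum_i ('D_v b x 0 i *: phi x (delta_mx 0 i)
            + b x 0 i *: 'D_v (phi ^~ (delta_mx 0 i)) x).
  move=> db; rewrite derive_bigsum => [|i].
    apply: eq_bigr => i _.
    rewrite (@derive_scale _ (fun y => b y 0 i) (phi ^~ (delta_mx 0 i)))//.
      by rewrite derive_entry.
    exact: differentiable_entry.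
  exact: (@differentiable_scale _ (fun y => b y 0 i) (phi ^~ (delta_mx 0 i))
    _ (differentiable_entry i db) (dphi _)).
rewrite expand dS// (expand (cst (a x))) dS; last exact: differentiable_cst.
rewrite [phi x ('D_v a x)]linfam_sum// -big_split; apply: eq_bigr => i _ /=.
by rewrite derive_cst mxE scale0r add0r addrC.
Qed.

End Calculus.

(** * Functions of class C^k *)

Section Smoothness.
Context {R : realType}.

Lemma open_near {T : topologicalType} (U : set T) x :
  open U -> U x -> \forall y \near x, U y.
Proof. by move=> oU Ux; apply: open_nbhs_nbhs. Qed.

Lemma Ck_sub {V W : normedModType R} k (U U' : set V) (f : V -> W) :
  U' `<=` U -> Ck k U f -> Ck k U' f.
Proof.
move=> sU; elim: k f => [|k IH] f /=; first by move=> cf x /sU; exact: cf.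
by move=> [df Df]; split=> [x /sU|v]; [exact: df|exact: IH].
Qed.

Lemma Ck_eq {V W : normedModType R} k (U : set V) (f g : V -> W) :
  open U -> (forall x, U x -> f x = g x) -> Ck k U f -> Ck k U g.
Proof.
move=> oU; have nearU x : U x -> (forall x, U x -> f x = g x) ->
    \forall y \near x, f y = g y.
  by move=> Ux fg; apply: filterS (open_near oU Ux) => y /fg.
elim: k f g nearU => [|k IH] f g nearU fg /=.
  move=> cf x Ux; rewrite /prop_for /continuous_at -(fg x Ux).
  by apply: cvg_trans (cf x Ux); apply: near_eq_cvg; exact: nearU.
move=> [df Df]; split=> [x Ux|v].
  by apply: near_eq_differentiable (df x Ux); exact: nearU.
apply: (IH ('D_v f)) (Df v) => x Ux.
  by move=> eqD; apply: filterS (open_near oU Ux) => y /eqD.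
by apply: near_eq_derive; exact: nearU.
Qed.

Lemma CkS {V W : normedModType R} k (U : set V) (f : V -> W) :
  Ck k.+1 U f -> Ck k U f.
Proof.
elim: k f => [|k IH] f [df Df].
  by move=> x Ux; exact/differentiable_continuous/df.
by split=> // v; apply: IH; exact: Df.
Qed.

Lemma Ck_bigsum {V W : normedModType R} k (U : set V) I (s : seq I)
    (f : I -> V -> W) : open U -> (forall i, Ck k U (f i)) ->
  Ck k U (fun x => \sum_(i <- s) f i x).
Proof.
move=> oU; elim: k f => [|k IH] f cf /=.
  move=> x Ux; elim: s => [|i s IHs].
    have -> : (fun y => \sum_(i <- [::]) f i y) = cst 0.
      by apply/funext => y; rewrite big_nil.
    exact: cvg_cst.
  have -> : (fun y => \sum_(j <- i :: s) f j y) =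
      f i + (fun y => \sum_(j <- s) f j y).
    by apply/funext => y; rewrite big_cons.
  exact: (continuousD (cf i x Ux) IHs).
split=> [x Ux|v].
  by apply: differentiable_bigsum => i; have [+ _] := cf i; exact.
apply: (@Ck_eq _ _ _ _ (fun x => \sum_(i <- s) 'D_v (f i) x)) => //.
  by move=> x Ux; rewrite derive_bigsum// => i; have [+ _] := cf i; exact.
by apply: IH => i; have [_] := cf i; exact.
Qed.

Lemma Ck_entry {V : normedModType R} n k (U : set V) (f : V -> 'rV[R]_n) i :
  open U -> Ck k U f -> Ck k U (fun x => f x 0 i).
Proof.
move=> oU; elim: k f => [|k IH] f /=.
  move=> cf x Ux; apply: (@continuous_comp _ _ _ f (fun M : 'rV[R]_n => M 0 i)).
    exact: cf.
  exact: coord_continuous.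
move=> [df Df]; split=> [x Ux|v]; first by apply: differentiable_entry; exact: df.
apply: (@Ck_eq _ _ _ _ (fun x => ('D_v f x) 0 i)) => //; last exact: IH.
by move=> x Ux; rewrite derive_entry//; exact: df.
Qed.

Lemma Ck_scale {V : normedModType R} n k (U : set V) (h : V -> R)
    (f : V -> 'rV[R]_n) : open U -> Ck k U h -> Ck k U f ->
  Ck k U (fun x => h x *: f x).
Proof.
move=> oU; elim: k h f => [|k IH] h f /=.
  by move=> ch cf x Ux; apply: cvgZ; [exact: ch|exact: cf].
move=> ckh ckf; have [dh Dh] := ckh; have [df Df] := ckf.
split=> [x Ux|v]; first by apply: differentiable_scale; [exact: dh|exact: df].
pose F (b : bool) x :=
  if b then 'D_v h x *: f x else h x *: 'D_v f x.
apply: (@Ck_eq _ _ _ _ (fun x => \sum_b F b x)) => //.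
  by move=> x Ux; rewrite big_bool derive_scale//; [exact: dh|exact: df].
apply: Ck_bigsum => // -[] /=; apply: IH => //.
  exact: (@CkS _ _ k U f).
exact: (@CkS _ _ k U h).
Qed.

(** By the chain rule, the derivatives of [g \o h] are combinations of the
    partial derivatives of g composed with h, with the entries of the
    derivatives of h as coefficients; this allows an induction on k. *)
Lemma Ck_comp {V : normedModType R} {W : normedModType R} m n k (U : set V)
    (U' : set 'rV[R]_m) (h : V -> 'rV[R]_m) (g : 'rV[R]_m -> 'rV[R]_n) :
  open U -> (forall x, U x -> U' (h x)) -> Ck k U h -> Ck k U' g ->
  Ck k U (g \o h).
Proof.
move=> oU hU; elim: k g => [|k IH] g /=.
  by move=> ch cg x Ux; apply: continuous_comp; [exact: ch|exact/cg/hU].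
move=> ckh [dg Dg]; have [dh Dh] := ckh; split=> [x Ux|v].
  by apply: differentiable_comp; [exact: dh|exact/dg/hU].
apply: (@Ck_eq _ _ _ _
  (fun x => \sum_i ('D_v h x) 0 i *: ('D_(delta_mx 0 i) g \o h) x)) => //.
  move=> x Ux; have dgx := dg _ (hU x Ux); rewrite (derive_comp v (dh x Ux) dgx).
  rewrite -linfam_sum// => a u w; exact: derive_addv.
apply: Ck_bigsum => // i; apply: Ck_scale => //; last exact: IH (CkS ckh) (Dg _).
by apply: Ck_entry => //; exact: Dh.
Qed.

End Smoothness.

(** * Symmetry of mixed derivatives *)

Section MixedDerivatives.
Context {R : realType}.

Lemma is_derive_line {V W : normedModType R} (f : V -> W) (p u : V) (t : R) :
  differentiable f (p + t *: u) ->
  is_derive t 1 (fun s : R => f (p + s *: u)) ('D_u f (p + t *: u)).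
Proof.
move=> df; pose h (s : R) := p + s *: u.
have dZ : differentiable (fun s : R => s *: u) t by exact: differentiableZl.
have dc : differentiable (cst p : R -> V) t by exact: differentiable_cst.
have dh : differentiable h t by exact: (differentiableD dc dZ).
have Dh : 'D_1 h t = u.
  rewrite (_ : h = cst p + (fun s : R => s *: u))//.
  rewrite (deriveD (diff_derivable dc) (diff_derivable dZ)).
  rewrite derive_cst add0r deriveE// diffZl//= diff_val.
  by rewrite scale1r.
apply: DeriveDef; last by have := derive_comp (1 : R) dh df; rewrite Dh.
exact/diff_derivable/(differentiable_comp dh).
Qed.

(** The mean value theorem, used first in the direction u for the increment
    of f under a shift by s v, then in the direction v. *)
Lemma second_difference {V : normedModType R} (U : set V) (f : V -> R)
    (x u v : V) (s : R) : 0 <= s -> Ck 2 U f ->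
  (forall a b, 0 <= a <= s -> 0 <= b <= s -> U (x + a *: u + b *: v)) ->
  exists a b, [/\ 0 <= a <= s, 0 <= b <= s &
   f (x + s *: u + s *: v) - f (x + s *: u) - f (x + s *: v) + f x =
   'D_v ('D_u f) (x + a *: u + b *: v) * s * s].
Proof.
move=> s0 [df Df] sU.
have ss : 0 <= s <= s by rewrite s0 lexx.
have zs : 0 <= (0 : R) <= s by rewrite lexx.
pose g a := f (x + s *: v + a *: u) - f (x + a *: u).
have dg a : 0 <= a <= s -> is_derive a 1 g
    ('D_u f (x + s *: v + a *: u) - 'D_u f (x + a *: u)).
  move=> a0; apply: is_deriveB; apply: is_derive_line; apply: df.
    by rewrite addrAC; exact: sU.
  by have := sU a 0 a0 zs; rewrite scale0r addr0.
have sub a : a \in `]0, s[ -> 0 <= a <= s.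
  by rewrite in_itv => /andP[a0 a1]; rewrite !ltW.
have cont (h dh : R -> R) : (forall a, 0 <= a <= s -> is_derive a 1 h (dh a)) ->
    {within `[0, s], continuous h}.
  move=> dh0; apply: derivable_within_continuous => a.
  by rewrite in_itv => /= a0; have [] := dh0 a a0.
have [a] := MVT_segment s0 (fun a aI => dg a (sub a aI)) (cont _ _ dg).
rewrite in_itv /= => a0; rewrite subr0 => eqg.
pose k b := 'D_u f (x + a *: u + b *: v).
have dk b : 0 <= b <= s -> is_derive b 1 k ('D_v ('D_u f) (x + a *: u + b *: v)).
  move=> b0; apply: is_derive_line; have [+ _] := Df u; apply; exact: sU.
have [b] := MVT_segment s0 (fun a aI => dk a (sub a aI)) (cont _ _ dk).
rewrite in_itv /= => b0; rewrite subr0 => eqk.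
exists a, b; split=> //; rewrite -eqk /k scale0r addr0 [x + a *: u + _]addrAC -eqg.
rewrite /g !scale0r !addr0 [x + s *: v + _]addrAC; ring.
Qed.

(** The second difference of f is symmetric in u and v.  Expressing it by
    either mixed derivative shows that these take a common value at points
    arbitrarily close to x, and both are continuous at x. *)
Lemma schwarz_scalar {V : normedModType R} (U : set V) (f : V -> R)
    (x u v : V) : open U -> U x -> Ck 2 U f ->
  'D_u ('D_v f) x = 'D_v ('D_u f) x.
Proof.
move=> oU Ux ckf; have [df Df] := ckf.
apply/eqP; rewrite -subr_eq0 -normr_le0 leNgt; apply/negP => dgt0.
set A := 'D_u ('D_v f) x in dgt0 *; set B := 'D_v ('D_u f) x in dgt0 *.
pose e := `|A - B| / 2.
have e0 : 0 < e by rewrite divr_gt0.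
have cA : 'D_u ('D_v f) y @[y --> x] --> A.
  by have [_ Dv] := Df v; exact: (Dv u x Ux).
have cB : 'D_v ('D_u f) y @[y --> x] --> B.
  by have [_ Du] := Df u; exact: (Du v x Ux).
have nA : \forall y \near x, `|A - 'D_u ('D_v f) y| < e.
  exact: (@cvgr_dist_lt _ _ _ _ _ _ _ cA).
have nB : \forall y \near x, `|B - 'D_v ('D_u f) y| < e.
  exact: (@cvgr_dist_lt _ _ _ _ _ _ _ cB).
have : \forall y \near x, [/\ `|A - 'D_u ('D_v f) y| < e,
    `|B - 'D_v ('D_u f) y| < e & U y].
  exact: filterS3 nA nB (open_near oU Ux).
move=> /nbhs_ballP[r /= r0 rP].
(* small enough for the parallelogram spanned by s u and s v to stay in the
   ball of radius r *)
pose s := r / (`|u| + `|v| + 1).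
have uv0 : 0 < `|u| + `|v| + 1 by rewrite ltr_wpDl// addr_ge0.
have s0 : 0 < s by rewrite divr_gt0.
have inball a b : 0 <= a <= s -> 0 <= b <= s -> ball x r (x + a *: u + b *: v).
  move=> /andP[a0 a1] /andP[b0 b1].
  rewrite -ball_normE /= -addrA opprD addrA subrr sub0r normrN.
  apply: le_lt_trans (ler_normD _ _) _; rewrite !normrZ !ger0_norm//.
  have : a * `|u| + b * `|v| <= s * (`|u| + `|v|).
    by rewrite mulrDr lerD// ler_wpM2r.
  move=> /le_lt_trans; apply.
  have -> : r = s * (`|u| + `|v| + 1) by rewrite /s divfK// gt_eqF.
  by rewrite ltr_pM2l// ltrDl.
have [a [b [a0 b0 E1]]] := second_difference (ltW s0) ckf
  (fun a b a0 b0 => let: And3 _ _ h := rP _ (inball a b a0 b0) in h).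
have inball' a' b' : 0 <= a' <= s -> 0 <= b' <= s ->
  ball x r (x + a' *: v + b' *: u).
  by move=> *; rewrite addrAC; exact: inball.
have [a' [b' [a'0 b'0 E2]]] := second_difference (ltW s0) ckf
  (fun a b a0 b0 => let: And3 _ _ h := rP _ (inball' a b a0 b0) in h).
have swap : f (x + s *: u + s *: v) - f (x + s *: u) - f (x + s *: v) + f x =
    f (x + s *: v + s *: u) - f (x + s *: v) - f (x + s *: u) + f x.
  by congr (_ + _); rewrite addrAC [x + s *: u + _]addrAC.
have E : 'D_v ('D_u f) (x + a *: u + b *: v) = 'D_u ('D_v f) (x + a' *: v + b' *: u).
  have ss0 := lt0r_neq0 s0.
  exact: mulIf ss0 _ _ (mulIf ss0 (etrans (esym E1) (etrans swap E2))).
have [_ lB _] := rP _ (inball a b a0 b0).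
have [lA _ _] := rP _ (inball' a' b' a'0 b'0).
have dist_half (z : R) : `|A - z| < e -> `|B - z| < e -> False.
  move=> Az; rewrite distrC => zB.
  have := le_lt_trans (ler_distD z A B) (ltrD Az zB).
  by rewrite /e -splitr ltxx.
apply: (dist_half _ lA); rewrite -E; exact: lB.
Qed.

Lemma schwarz {V : normedModType R} n (U : set V) (f : V -> 'rV[R]_n)
    (x u v : V) : open U -> U x -> Ck 2 U f ->
  'D_u ('D_v f) x = 'D_v ('D_u f) x.
Proof.
move=> oU Ux ckf; have [df Df] := ckf.
have DDf w w' i : 'D_w ('D_w' f) x 0 i = 'D_w ('D_w' (fun y => f y 0 i)) x.
  rewrite -derive_entry; last by have [+ _] := Df w'; exact.
  apply: near_eq_derive; apply: filterS (open_near oU Ux) => y Uy.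
  by rewrite derive_entry//; exact: df.
apply/rowP => i; apply: etrans (DDf u v i) _.
apply: etrans _ (esym (DDf v u i)).
have cki := Ck_entry i oU ckf.
exact: (schwarz_scalar u v oU Ux cki).
Qed.

End MixedDerivatives.

(** * Smooth germs and charts *)

Section SmoothGerms.
Context {R : realType} {V : normedModType R}.

Lemma smooth_near_set {W : normedModType R} (f : V -> W) x (A : set V) :
  smooth_near f x -> (\forall y \near x, A y) ->
  exists U, [/\ open U, U x, U `<=` A & smooth_on U f].
Proof.
move=> [U [oU Ux] sf] nA; exists (U `&` A°); split.
- exact: openI oU (open_interior A).
- by split.
- by move=> y [_ /interior_subset].
- by move=> k; apply: Ck_sub (sf k); exact: subIsetl.
Qed.

Lemma smooth_near_eq {W : normedModType R} (f g : V -> W) x :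
  (\forall y \near x, f y = g y) -> smooth_near f x -> smooth_near g x.
Proof.
move=> fg sf; have [U [oU Ux UA sU]] := smooth_near_set sf fg.
by exists U => // k; apply: Ck_eq (sU k).
Qed.

Lemma smooth_near_near {W : normedModType R} (f : V -> W) x :
  smooth_near f x -> \forall y \near x, smooth_near f y.
Proof.
move=> [U [oU Ux] sf].
by apply: filterS (open_near oU Ux) => y Uy; exists U.
Qed.

Lemma smooth_near_differentiable {W : normedModType R} (f : V -> W) x :
  smooth_near f x -> differentiable f x.
Proof. by move=> [U [oU Ux] /(_ 1%N)[df _]]; exact: df. Qed.

Lemma smooth_near_derive {W : normedModType R} (f : V -> W) v x :
  smooth_near f x -> smooth_near ('D_v f) x.
Proof. by move=> [U oU sf]; exists U => // k; have [_] := sf k.+1; exact. Qed.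

Lemma smooth_near_cst {W : normedModType R} (w : W) x :
  smooth_near (cst w : V -> W) x.
Proof.
exists setT; first by split=> //; exact: openT.
move=> k; elim: k w => [|k IH] w /=; first by move=> y _; exact: cvg_cst.
split=> [y _|v]; first exact: differentiable_cst.
have -> : (fun y => 'D_v (cst w : V -> W) y) = cst 0.
  by apply/funext => y; rewrite derive_cst.
exact: IH.
Qed.

Lemma smooth_near_entry n (f : V -> 'rV[R]_n) i x :
  smooth_near f x -> smooth_near (fun y => f y 0 i) x.
Proof.
by move=> [U [oU Ux] sf]; exists U => // k; apply: Ck_entry => //; exact: sf.
Qed.

Lemma smooth_near_scale n (h : V -> R) (f : V -> 'rV[R]_n) x :
  smooth_near h x -> smooth_near f x -> smooth_near (fun y => h y *: f y) x.
Proof.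
move=> [U [oU Ux] sh] [U' [oU' U'x] sf].
exists (U `&` U'); first by split=> //; exact: openI.
move=> k; apply: Ck_scale; first exact: openI.
  by apply: Ck_sub (sh k); exact: subIsetl.
by apply: Ck_sub (sf k); exact: subIsetr.
Qed.

Lemma smooth_near_add {W : normedModType R} (f g : V -> W) x :
  smooth_near f x -> smooth_near g x -> smooth_near (fun y => f y + g y) x.
Proof.
move=> [U [oU Ux] sf] [U' [oU' U'x] sg].
exists (U `&` U'); first by split=> //; exact: openI.
move=> k; pose F (b : bool) := if b then f else g.
apply: (@Ck_eq _ _ _ _ _ (fun y => \sum_b F b y)); first exact: openI.
  by move=> y _; rewrite big_bool.
apply: Ck_bigsum; first exact: openI.
case; first by apply: Ck_sub (sf k); exact: subIsetl.
by apply: Ck_sub (sg k); exact: subIsetr.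
Qed.

Lemma smooth_near_comp m n (h : V -> 'rV[R]_m) (g : 'rV[R]_m -> 'rV[R]_n) x :
  smooth_near h x -> smooth_near g (h x) -> smooth_near (g \o h) x.
Proof.
move=> sh [U' [oU' U'x] sg].
have nA : \forall y \near x, U' (h y).
  have := differentiable_continuous (smooth_near_differentiable sh).
  exact: (fun c => c _ (open_near oU' U'x)) .
have [U [oU Ux UA sU]] := smooth_near_set sh nA.
by exists U => // k; apply: Ck_comp (sU k) (sg k).
Qed.

(** This is what makes the third derivatives of the immersion disappear from
    the antisymmetrized Gauss formula. *)
Lemma smooth_near_schwarz n (f : V -> 'rV[R]_n) u v x :
  smooth_near f x -> 'D_u ('D_v f) x = 'D_v ('D_u f) x.
Proof. by move=> [U [oU Ux] sf]; exact: schwarz oU Ux (sf 2). Qed.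

End SmoothGerms.

Section Charts.
Context {R : realType} {d : nat} (M : manifold R d).
Implicit Types (p q r s : M) (u v w : 'rV[R]_d) (X Y Z : vfield M).

Lemma chart_inv_near p r (P : M -> Prop) : dom p r ->
  (\forall q \near r, P q) -> \forall x \near chart p r, P (chart_inv p x).
Proof.
move=> pr nP; apply: (@chart_inv_continuous _ _ M p (chart p r)).
  by exists r.
by rewrite chartK.
Qed.

Lemma codom_near p r : dom p r ->
  \forall x \near chart p r, dom p (chart_inv p x) /\ chart p (chart_inv p x) = x.
Proof.
move=> pr; apply: filterS (open_near (@codom_open _ _ M p) _); last by exists r.
by move=> _ [q pq <-]; rewrite chartK.
Qed.

Lemma dom_near p r : dom p r -> \forall q \near r, dom p q.
Proof. by move=> pr; apply: open_near => //; exact: dom_open. Qed.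

Lemma localrepE p X x : localrep p X x =
  transfer (chart_inv p x) p (chart_inv p x) (X (chart_inv p x)).
Proof. by []. Qed.

(** Unlike [transition_smooth], this speaks of a neighbourhood of a single
    point, which is the form in which smoothness is composed below. *)
Lemma transition_near p q r : dom p r -> dom q r ->
  smooth_near (chart q \o chart_inv p) (chart p r).
Proof.
move=> pr qr; exists (chart p @` (dom p `&` dom q)); last exact: transition_smooth.
split; last by exists r.
rewrite openE => _ [s [ps qs] <-].
have nq := chart_inv_near ps (dom_near qs).
apply: filterS2 (codom_near ps) nq => x [px xE] qx.
by exists (chart_inv p x).
Qed.

Lemma transition_diff p q r : dom p r -> dom q r ->
  differentiable (chart q \o chart_inv p) (chart p r).
Proof. by move=> pr qr; exact/smooth_near_differentiable/transition_near. Qed.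

Lemma transfer_linear p q r : dom p r -> dom q r -> linear (transfer p q r).
Proof. by move=> pr qr a u v; apply: derive_addv; exact: transition_diff. Qed.

(** The chain rule for the transition maps. *)
Lemma transfer_trans p q s r u : dom p r -> dom q r -> dom s r ->
  transfer q s r (transfer p q r u) = transfer p s r u.
Proof.
move=> pr qr sr; rewrite /transfer.
have E : (chart q \o chart_inv p) (chart p r) = chart q r by rewrite /= chartK.
have dq := transition_diff qr sr; rewrite -E in dq.
have := derive_comp u (transition_diff pr qr) dq; rewrite E => <-.
apply: near_eq_derive.
apply: filterS (chart_inv_near pr (dom_near qr)) => x qx /=.
by rewrite chartK.
Qed.

Lemma transfer_id p r u : dom p r -> transfer p p r u = u.
Proof.
move=> pr; rewrite /transfer -[RHS](derive_id (chart p r) u).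
by apply: near_eq_derive; apply: filterS (codom_near pr) => x [].
Qed.

Lemma transferK p q r u : dom p r -> dom q r ->
  transfer q p r (transfer p q r u) = u.
Proof. by move=> pr qr; rewrite transfer_trans// transfer_id. Qed.

Lemma localrep_chart p q X : dom p q ->
  localrep p X (chart p q) = transfer q p q (X q).
Proof. by move=> pq; rewrite /localrep chartK. Qed.

Lemma coord_field_self p u : coord_field p u p = u.
Proof. by apply: transfer_id; exact: dom_mem. Qed.

Lemma coord_field_localrep p q X : dom p q ->
  coord_field p (localrep p X (chart p q)) q = X q.
Proof.
by move=> pq; rewrite localrep_chart// /coord_field transferK//; exact: dom_mem.
Qed.

Lemma localrep_coord_field p q u : dom p q ->
  localrep p (coord_field p u) (chart p q) = u.
Proof.
by move=> pq; rewrite localrep_chart// /coord_field transferK//; exact: dom_mem.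
Qed.

Lemma coord_field_linear p q : dom p q -> linear (fun u => coord_field p u q).
Proof. by move=> pq; apply: transfer_linear => //; exact: dom_mem. Qed.

Lemma near_localrep p q X Y : dom p q -> (\forall r \near q, X r = Y r) ->
  \forall x \near chart p q, localrep p X x = localrep p Y x.
Proof.
move=> pq XY; apply: filterS (chart_inv_near pq XY) => x xE.
by rewrite /localrep xE.
Qed.

Lemma smooth_field_eq p X Y : (\forall q \near p, X q = Y q) ->
  smooth_field_at p X -> smooth_field_at p Y.
Proof.
by move=> XY; apply: smooth_near_eq; apply: near_localrep => //; exact: dom_mem.
Qed.

(** With tau the transition map from the chart around p to the one around q,
    the components of the field in the latter are [D_u tau \o tau^-1]. *)
Lemma coord_field_smooth p q u : dom p q -> smooth_field_at q (coord_field p u).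
Proof.
move=> pq; have qq := dom_mem q.
apply: (@smooth_near_eq _ _ _
  ('D_u (chart q \o chart_inv p) \o (chart p \o chart_inv q))).
  apply: filterS2 (codom_near qq) (chart_inv_near qq (dom_near pq)) => x [qx xE] px.
  exact: (esym (transfer_trans u px (dom_mem (chart_inv q x)) qx)).
apply: smooth_near_comp; first exact: transition_near.
by rewrite /= chartK//; apply: smooth_near_derive; exact: transition_near.
Qed.

Lemma smooth_field_add p X Y : smooth_field_at p X -> smooth_field_at p Y ->
  smooth_field_at p (fun q => X q + Y q).
Proof.
move=> sX sY; apply: smooth_near_eq (smooth_near_add sX sY).
apply: filterS (codom_near (dom_mem p)) => x [px _].
exact: esym (linD (transfer_linear (dom_mem (chart_inv p x)) px) _ _).
Qed.

Lemma smooth_field_scale p (h : M -> R) X : smooth_fun_at p h ->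
  smooth_field_at p X -> smooth_field_at p (fun q => h q *: X q).
Proof.
move=> sh sX; apply: smooth_near_eq (smooth_near_scale sh sX).
apply: filterS (codom_near (dom_mem p)) => x [px _].
exact: esym (linZ (transfer_linear (dom_mem (chart_inv p x)) px) _ _).
Qed.

End Charts.

(** * Connections in a chart *)

Section Connections.
Context {R : realType} {d : nat} (M : manifold R d) (D : connection M).
Implicit Types (p q r s : M) (a b c u v w : 'rV[R]_d) (X Y Z : vfield M).

(** Let h be the indicator function of the set where Y = Z.  The fields h Y
    and h Z coincide everywhere, and since h = 1 near p the Leibniz rule gives
    them at p the same covariant derivatives as Y and Z. *)
Lemma cov_germ p v Y Z : smooth_field_at p Y ->
  (\forall q \near p, Y q = Z q) -> D p v Y = D p v Z.
Proof.
move=> sY YZ; have sZ := smooth_field_eq YZ sY.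
pose h q : R := (`[< Y q = Z q >])%:R.
have h1 : \forall x \near chart p p, (cst 1 : 'rV[R]_d -> R) x = (h \o chart_inv p) x.
  apply: filterS (chart_inv_near (dom_mem p) YZ) => x xE.
  by rewrite /= /h asboolT.
have sh : smooth_fun_at p h.
  by apply: smooth_near_eq h1 _; exact: smooth_near_cst.
have hp : h p = 1 by rewrite /h asboolT//; exact: nbhs_singleton YZ.
have dh : dirder p v h = 0.
  by rewrite /dirder -(near_eq_derive v h1) derive_cst.
have hYZ : (fun q => h q *: Y q) = (fun q => h q *: Z q).
  apply/funext => q; rewrite /h; case: asboolP => [->//|_].
  by rewrite !scale0r.
have := cov_leibniz D v sh sY; rewrite hYZ cov_leibniz// dh hp.
by rewrite !scale0r !add0r !scale1r.
Qed.

Lemma smooth_fun_cst p (k : R) : smooth_fun_at p (fun _ => k).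
Proof. exact: smooth_near_cst. Qed.

Lemma cov0 p Y : smooth_field_at p Y -> D p 0 Y = 0.
Proof.
by move=> sY; apply: (@lin0 _ _ _ (fun v => D p v Y)) => a u v; exact: cov_linear.
Qed.

Lemma smooth_field0 p : smooth_field_at p (fun _ => 0).
Proof.
apply: (@smooth_near_eq _ _ _ (cst 0)); last exact: smooth_near_cst.
apply: filterS (codom_near (dom_mem p)) => x [px _].
by rewrite localrepE (lin0 (transfer_linear (dom_mem (chart_inv p x)) px)).
Qed.

Lemma dirder_cst p v (k : R) : dirder p v (fun _ => k) = 0.
Proof. exact: derive_cst. Qed.

Lemma cov_zero_field p v : D p v (fun _ => 0) = 0.
Proof.
have := cov_leibniz D v (smooth_fun_cst p 0) (smooth_field0 p).
by rewrite dirder_cst !scale0r addr0.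
Qed.

Lemma smooth_field_sum p I (t : seq I) (y : I -> M -> R) (E : I -> vfield M) :
  (forall i, smooth_fun_at p (y i)) -> (forall i, smooth_field_at p (E i)) ->
  smooth_field_at p (fun q => \sum_(i <- t) y i q *: E i q).
Proof.
move=> sy sE; elim: t => [|i t IH].
  by under eq_fun do rewrite big_nil; exact: smooth_field0.
under eq_fun do rewrite big_cons.
exact: (smooth_field_add (smooth_field_scale (sy i) (sE i)) IH).
Qed.

Lemma cov_sum p v I (t : seq I) (y : I -> M -> R) (E : I -> vfield M) :
  (forall i, smooth_fun_at p (y i)) -> (forall i, smooth_field_at p (E i)) ->
  D p v (fun q => \sum_(i <- t) y i q *: E i q) =
  \sum_(i <- t) (dirder p v (y i) *: E i p + y i p *: D p v (E i)).
Proof.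
move=> sy sE; elim: t => [|i t IH].
  by under eq_fun do rewrite big_nil; rewrite big_nil cov_zero_field.
under eq_fun do rewrite big_cons.
rewrite big_cons cov_add ?cov_leibniz ?IH//; first exact: smooth_field_scale.
exact: smooth_field_sum.
Qed.

Lemma coord_field_sum p q u : dom p q -> coord_field p u q =
  \sum_i u 0 i *: coord_field p (delta_mx 0 i) q.
Proof. by move=> pq; apply: linfam_sum; exact: coord_field_linear. Qed.

Lemma cov_coord_sum p q v u : dom p q -> D q v (coord_field p u) =
  \sum_i u 0 i *: D q v (coord_field p (delta_mx 0 i)).
Proof.
move=> pq; have nq := dom_near pq.
rewrite (@cov_germ _ _ _ (fun r => \sum_i u 0 i *: coord_field p (delta_mx 0 i) r)).
- rewrite (@cov_sum _ _ _ _ (fun i _ => u 0 i)).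
  + by apply: eq_bigr => i _; rewrite dirder_cst scale0r add0r.
  + by move=> i; exact: smooth_fun_cst.
  + by move=> i; exact: coord_field_smooth.
- exact: coord_field_smooth.
- by apply: filterS nq => r pr; exact: coord_field_sum.
Qed.

Lemma cov_coord_linear p q v : dom p q -> linear (fun u => D q v (coord_field p u)).
Proof.
move=> pq k u w; have E := fun w => cov_coord_sum v w pq.
rewrite [LHS]E [X in _ = _ *: X + _]E [X in _ = _ + X]E scaler_sumr -big_split.
by apply: eq_bigr => i _; rewrite !mxE scalerDl scalerA.
Qed.

(** The usual formula, derivative of the components plus Christoffel term;
    it comes from the Leibniz rule after expanding Y in coordinate fields. *)
Lemma cov_localrep p v Y : smooth_field_at p Y ->
  D p v Y = 'D_v (localrep p Y) (chart p p) + D p v (coord_field p (Y p)).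
Proof.
move=> sY; have pp := dom_mem p.
pose y (i : 'I_d) q : R := localrep p Y (chart p q) 0 i.
have yE i : \forall x \near chart p p,
    localrep p Y x 0 i = (y i \o chart_inv p) x.
  by apply: filterS (codom_near pp) => x [px xE]; rewrite /= /y xE.
have sy i : smooth_fun_at p (y i).
  by apply: smooth_near_eq (yE i) _; exact: smooth_near_entry.
rewrite (@cov_germ _ _ _
  (fun q => \sum_i y i q *: coord_field p (delta_mx 0 i) q))//; last first.
  apply: filterS (dom_near pp) => q pq.
  by rewrite -(coord_field_localrep Y pq) coord_field_sum.
rewrite (cov_sum _ _ sy (fun i => coord_field_smooth (delta_mx 0 i) pp)).
rewrite big_split; congr (_ + _).
  rewrite [RHS]row_sum_delta; apply: eq_bigr => i _.
  rewrite coord_field_self /dirder -(near_eq_derive v (yE i)) derive_entry//.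
  exact: smooth_near_differentiable.
rewrite [RHS]cov_coord_sum//; apply: eq_bigr => i _; congr (_ *: _).
by rewrite /y localrep_chart// transfer_id.
Qed.

(** The vector field [nabla_{d_a} d_b] in coordinates, d_a and d_b being the
    fields with constant components a and b in the chart around p. *)
Definition christoffel p a b : 'rV[R]_d -> 'rV[R]_d :=
  localrep p (fun q => D q (coord_field p a q) (coord_field p b)).

Lemma christoffel_smooth p a b : smooth_near (christoffel p a b) (chart p p).
Proof. by apply: cov_smooth; exact/coord_field_smooth/dom_mem. Qed.

Lemma christoffel_diff p a b : differentiable (christoffel p a b) (chart p p).
Proof. exact/smooth_near_differentiable/christoffel_smooth. Qed.

Lemma christoffel_linearl p b x : dom p (chart_inv p x) ->
  linear (fun a => christoffel p a b x).
Proof.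
move=> px; have rr := dom_mem (chart_inv p x).
have sb := coord_field_smooth b px.
have lD : linear (fun v => D (chart_inv p x) v (coord_field p b)).
  by move=> k u v; exact: cov_linear.
exact: (lin_comp (lin_comp (coord_field_linear px) lD) (transfer_linear rr px)).
Qed.

Lemma christoffel_linearr p a x : dom p (chart_inv p x) ->
  linear (fun b => christoffel p a b x).
Proof.
move=> px; have rr := dom_mem (chart_inv p x).
exact: (lin_comp (cov_coord_linear (coord_field p a (chart_inv p x)) px)
  (transfer_linear rr px)).
Qed.

Lemma christoffelE p q a b : dom p q ->
  coord_field p (christoffel p a b (chart p q)) q =
  D q (coord_field p a q) (coord_field p b).
Proof. by move=> pq; rewrite coord_field_localrep. Qed.

(** The classical expression of R(a, b) c through Christoffel symbols. *)
Definition riemann p a b c : 'rV[R]_d :=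
  let G := christoffel p in let x := chart p p in
  'D_a (G b c) x - 'D_b (G a c) x + G a (G b c x) x - G b (G a c x) x.

Lemma bracket_coord_field p a b :
  bracket (coord_field p a) (coord_field p b) p = 0.
Proof.
have cst_rep u v : 'D_v (localrep p (coord_field p u)) (chart p p) = 0 :> 'rV[R]_d.
  rewrite -[RHS](derive_cst u (chart p p) v); apply: near_eq_derive.
  apply: filterS (codom_near (dom_mem p)) => x [px xE].
  by rewrite -[in LHS]xE localrep_coord_field.
by rewrite /bracket [X in X - _]cst_rep [X in _ - X]cst_rep subrr.
Qed.

(** Coordinate fields commute, so the bracket term of the curvature drops
    out. *)
Lemma curvature_coord p a b c :
  curvature D (coord_field p a) (coord_field p b) (coord_field p c) p =
  riemann p a b c.
Proof.
have pp := dom_mem p.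
have chp u v : christoffel p u v (chart p p) = D p u (coord_field p v).
  rewrite -[LHS](coord_field_self p) [LHS](christoffelE u v pp).
  by rewrite coord_field_self.
have nabnab u v : nab D (coord_field p u)
    (nab D (coord_field p v) (coord_field p c)) p =
    'D_u (christoffel p v c) (chart p p)
    + christoffel p u (christoffel p v c (chart p p)) (chart p p).
  have sY : smooth_field_at p (nab D (coord_field p v) (coord_field p c)).
    by apply: cov_smooth; exact: coord_field_smooth.
  apply: etrans (cov_localrep _ sY) _; rewrite coord_field_self.
  congr (_ + _); rewrite [RHS]chp; congr (D p u (coord_field p _)).
  by rewrite [RHS]chp /nab coord_field_self.
rewrite /curvature [X in X - _ - _]nabnab [X in _ - X - _]nabnab.
rewrite [X in _ - X](_ : _ = 0); last first.
  rewrite /nab bracket_coord_field; apply: cov0; exact: coord_field_smooth.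
rewrite subr0 /riemann opprD !addrA; congr (_ - _).
by rewrite -!addrA; congr (_ + _); rewrite addrC.
Qed.

Lemma near_codom p : \forall x \near chart p p, dom p (chart_inv p x).
Proof. by apply: filterS (codom_near (dom_mem p)) => x []. Qed.

Lemma derive_christoffel_lin p v (k : R) (G1 G2 G3 : 'rV[R]_d -> 'rV[R]_d) :
  differentiable G1 (chart p p) -> differentiable G2 (chart p p) ->
  (\forall x \near chart p p, G3 x = k *: G1 x + G2 x) ->
  'D_v G3 (chart p p) = k *: 'D_v G1 (chart p p) + 'D_v G2 (chart p p).
Proof.
move=> d1 d2 /near_eq_derive ->.
rewrite (deriveD (diff_derivable (differentiableZ _ d1)) (diff_derivable d2)).
by rewrite deriveZ//; exact: diff_derivable.
Qed.

Lemma derive_christoffel_linear (F : 'rV[R]_d -> 'rV[R]_d -> 'rV[R]_d) p v :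
  (forall b, differentiable (F b) (chart p p)) ->
  (\forall x \near chart p p, linear (F ^~ x)) ->
  linear (fun b => 'D_v (F b) (chart p p) : 'rV[R]_d).
Proof.
move=> dF lF k b b'; apply: derive_christoffel_lin => //.
by apply: filterS lF => x; exact.
Qed.

Lemma riemann_linear3 p a b : linear (fun c => riemann p a b c).
Proof.
have px := nbhs_singleton (near_codom p).
have lD u v : linear (fun c => 'D_u (christoffel p v c) (chart p p) : 'rV[R]_d).
  apply: derive_christoffel_linear => [c|]; first exact: christoffel_diff.
  by apply: filterS (near_codom p) => x; exact: christoffel_linearr.
have lG u v : linear (fun c => christoffel p u
    (christoffel p v c (chart p p)) (chart p p)).
  exact: lin_comp (christoffel_linearr v px) (christoffel_linearr u px).
exact: (lin_sub (lin_add (lin_sub (lD a b) (lD b a)) (lG a b)) (lG b a)).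
Qed.

Lemma riemann_antisym p a b c : riemann p b a c = - riemann p a b c.
Proof.
have swap (A B A' B' : 'rV[R]_d) : B - A + B' - A' = - (A - B + A' - B').
  by apply/rowP => i; rewrite !mxE; ring.
exact: swap.
Qed.

Lemma riemann_linear1 p b c : linear (fun a => riemann p a b c).
Proof.
have px := nbhs_singleton (near_codom p).
have lD : linear (fun a => 'D_b (christoffel p a c) (chart p p) : 'rV[R]_d).
  apply: derive_christoffel_linear => [a|]; first exact: christoffel_diff.
  by apply: filterS (near_codom p) => x; exact: christoffel_linearl.
have lE : linear (fun a => 'D_a (christoffel p b c) (chart p p) : 'rV[R]_d).
  by move=> k u v; apply: derive_addv; exact: christoffel_diff.
have lG := christoffel_linearl (christoffel p b c (chart p p)) px.
have lH := lin_comp (christoffel_linearl c px) (christoffel_linearr b px).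
exact: (lin_sub (lin_add (lin_sub lE lD) lG) lH).
Qed.

Lemma riemann_linear2 p a c : linear (fun b => riemann p a b c).
Proof.
have -> : (fun b => riemann p a b c) = (fun b => - riemann p b a c).
  by apply/funext => b; exact: riemann_antisym.
by move=> k b b'; rewrite riemann_linear1 opprD scalerN.
Qed.

End Connections.

Section StatisticalCurvature.
Context {R : realType} {d : nat} (M : manifold R d) (D Ds : connection M).

Lemma Scurv_riemann (p : M) u v w :
  Scurv D Ds p u v w = 2^-1 *: (riemann D p u v w + riemann Ds p u v w).
Proof.
rewrite /Scurv /stat_curvature; congr (_ *: _).
by congr (_ + _); exact: curvature_coord.
Qed.

Lemma Scurv_linear2 (p : M) u w : linear (fun v => Scurv D Ds p u v w).
Proof.
have -> : (fun v => Scurv D Ds p u v w) =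
    (fun v => 2^-1 *: (riemann D p u v w + riemann Ds p u v w)).
  by apply/funext => v; exact: Scurv_riemann.
apply: lin_scale; apply: lin_add; exact: riemann_linear2.
Qed.

Lemma Scurv_linear3 (p : M) u v : linear (fun w => Scurv D Ds p u v w).
Proof.
have -> : (fun w => Scurv D Ds p u v w) =
    (fun w => 2^-1 *: (riemann D p u v w + riemann Ds p u v w)).
  by apply/funext => w; exact: Scurv_riemann.
apply: lin_scale; apply: lin_add; exact: riemann_linear3.
Qed.

End StatisticalCurvature.

(** * The Gauss equation *)

Section ChartChange.
Context {R : realType} {d : nat} (M : manifold R d) (D : connection M).

Lemma coord_field_inj (p q : M) : dom p q -> injective (fun u => coord_field p u q).
Proof.
by move=> pq; apply: (can_inj (g := transfer q p q)) => u; exact: transferK (dom_mem q).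
Qed.

(** The inhomogeneous transformation law of Christoffel symbols: replacing a
    field with constant components around p by the one with constant
    components around q costs a second derivative of the transition map. *)
Lemma cov_chart_change (p q : M) a b : dom p q ->
  D q (coord_field p a q) (coord_field q (coord_field p b q)) =
  D q (coord_field p a q) (coord_field p b)
  - 'D_a ('D_b (chart q \o chart_inv p)) (chart p q).
Proof.
move=> pq; have qq := dom_mem q.
pose A := coord_field p a q; pose tau := chart q \o chart_inv p.
have sb := coord_field_smooth b pq.
have stau := smooth_near_derive b (transition_near pq qq).
have lE : \forall x \near chart q q, localrep q (coord_field p b) x =
    ('D_b tau \o (chart p \o chart_inv q)) x.
  apply: filterS2 (codom_near qq) (chart_inv_near qq (dom_near pq)) => x [qx xE] px.
  exact: transfer_trans b px (dom_mem (chart_inv q x)) qx.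
have tE : (chart p \o chart_inv q) (chart q q) = chart p q by rewrite /= chartK.
have dtau : differentiable ('D_b tau) ((chart p \o chart_inv q) (chart q q)).
  by rewrite tE; exact: smooth_near_differentiable.
have DE : 'D_A (localrep q (coord_field p b)) (chart q q) =
    'D_a ('D_b tau) (chart p q).
  apply: etrans (near_eq_derive A lE) _.
  apply: etrans (derive_comp A (transition_diff qq pq) dtau) _.
  rewrite tE (_ : 'D_A _ _ = a)//; exact: transferK.
have key := cov_localrep D A sb; rewrite DE in key.
have move_term (B C E : 'rV[R]_d) : E = B + C -> C = E - B.
  by move=> ->; rewrite [B + C]addrC addrK.
exact: move_term key.
Qed.

End ChartChange.

Section Gauss.
Context {R : realType} {d e : nat} {M : manifold R d} {N : manifold R e}.
Variables (f : M -> N) (f_smooth : smooth_map f).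
Implicit Types (p q : M) (u v w : 'rV[R]_d).

Lemma map_rep_near p q : dom p q -> dom (f p) (f q) ->
  smooth_near (map_rep f p) (chart p q).
Proof.
move=> pq fpq; have [cf sf] := f_smooth.
have qq := dom_mem q; have fqq := dom_mem (f q).
apply: (@smooth_near_eq _ _ _ ((chart (f p) \o chart_inv (f q)) \o
  (map_rep f q \o (chart q \o chart_inv p)))).
  have nf : \forall r \near q, dom (f q) (f r).
    by apply: (cf q); exact: dom_near.
  apply: filterS2 (chart_inv_near pq (dom_near qq)) (chart_inv_near pq nf).
  by move=> x qx fqx; rewrite /map_rep /= chartK// chartK.
have E : (chart q \o chart_inv p) (chart p q) = chart q q by rewrite /= chartK.
apply: smooth_near_comp.
  apply: smooth_near_comp; first exact: transition_near.
  by rewrite E; exact: sf.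
rewrite /= chartK// /map_rep /= chartK//.
exact: transition_near.
Qed.

Lemma map_rep_chart p q : dom p q -> map_rep f p (chart p q) = chart (f p) (f q).
Proof. by move=> pq; rewrite /map_rep /= chartK. Qed.

(** Both sides are the derivative of f read from the chart around p to the
    chart around f q. *)
Lemma tangent_map_coord p q u : dom p q -> dom (f p) (f q) ->
  tangent_map f q (coord_field p u q) =
  coord_field (f p) ('D_u (map_rep f p) (chart p q)) (f q).
Proof.
move=> pq fpq; have [cf sf] := f_smooth.
have qq := dom_mem q; have fqq := dom_mem (f q).
have E : (chart q \o chart_inv p) (chart p q) = chart q q by rewrite /= chartK.
have dF := smooth_near_differentiable (map_rep_near pq fpq).
have dFq : differentiable (map_rep f q) ((chart q \o chart_inv p) (chart p q)).
  by rewrite E; exact: smooth_near_differentiable (sf q).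
have := derive_comp u (transition_diff pq qq) dFq; rewrite E => lhsE.
have dt : differentiable (chart (f q) \o chart_inv (f p)) (map_rep f p (chart p q)).
  by rewrite (map_rep_chart pq); exact: transition_diff.
have := derive_comp u dF dt; rewrite (map_rep_chart pq) => rhsE.
have nf : \forall r \near q, dom (f p) (f r).
  by apply: (cf q); exact: dom_near.
apply: etrans (esym lhsE) (etrans _ rhsE); apply: near_eq_derive.
apply: filterS2 (chart_inv_near pq (dom_near qq)) (chart_inv_near pq nf).
by move=> x qx fpx; rewrite /map_rep /= (chartK qx) (chartK fpx).
Qed.

(** [cov_along] at q refers to the charts around q and f q, which change with
    q, so it has to be brought to the fixed charts around p and f p before it
    can be differentiated.  Differentiating the components of V in the chart
    around f q produces a second derivative of the transition map, which
    cancels the one of [cov_chart_change]. *)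
Lemma cov_along_coord (DN : connection N) p q (V : M -> 'rV[R]_e)
    (phi : 'rV[R]_d -> 'rV[R]_e) u :
  dom p q -> dom (f p) (f q) -> smooth_near phi (chart p q) ->
  (\forall r \near q, V r = coord_field (f p) (phi (chart p r)) (f r)) ->
  cov_along f DN V q (coord_field p u q) =
  coord_field (f p) ('D_u phi (chart p q) +
    christoffel DN (f p) ('D_u (map_rep f p) (chart p q)) (phi (chart p q))
      (chart (f p) (f q))) (f q).
Proof.
move=> pq fpq sphi VE; have [cf sf] := f_smooth.
have qq := dom_mem q; have fqq := dom_mem (f q).
pose F := map_rep f p; pose x := chart p q; pose a := 'D_u F x.
pose w := coord_field p u q.
pose tau := chart (f q) \o chart_inv (f p).
have sF : smooth_near F x := map_rep_near pq fpq.
have stau : smooth_near tau (F x).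
  by rewrite /F /x (map_rep_chart pq); exact: transition_near.
(* the components of V in the chart around f q *)
pose Psi y := 'D_(phi y) tau (F y).
have ntau : \forall y \near x, smooth_near tau (F y).
  have cF := differentiable_continuous (smooth_near_differentiable sF).
  exact: (cF _ (smooth_near_near stau)).
have lin_tau : \forall y \near x, linear (fun c => 'D_c tau (F y)).
  apply: filterS ntau => y sy k c c'.
  by apply: derive_addv; exact: smooth_near_differentiable.
have dtau c : differentiable (fun y => 'D_c tau (F y)) x.
  apply: (@differentiable_comp _ _ _ _ F ('D_c tau) _ (smooth_near_differentiable sF)).
  by apply: smooth_near_differentiable; exact: smooth_near_derive.
have dphi := smooth_near_differentiable sphi.
have dPsi : differentiable Psi x by exact: differentiable_linfam lin_tau dtau dphi.
have DPsi : 'D_u Psi x =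
    'D_a ('D_(phi x) tau) (F x) + coord_field (f p) ('D_u phi x) (f q).
  have e1 : 'D_u (fun y => 'D_(phi x) tau (F y)) x = 'D_a ('D_(phi x) tau) (F x).
    apply: (@derive_comp _ _ _ _ F ('D_(phi x) tau) x u
      (smooth_near_differentiable sF)).
    by apply: smooth_near_differentiable; exact: smooth_near_derive.
  have e2 : 'D_('D_u phi x) tau (F x) = coord_field (f p) ('D_u phi x) (f q).
    by rewrite /F /x (map_rep_chart pq).
  by rewrite -[in RHS]e1 -[in RHS]e2; exact: (derive_linfam u lin_tau dtau dphi).
have T1 : 'D_w (fun y => let r := chart_inv q y in
    transfer (f r) (f q) (f r) (V r)) (chart q q) = 'D_u Psi x.
  have E : (chart p \o chart_inv q) (chart q q) = x by rewrite /= chartK.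
  have dPsi' : differentiable Psi ((chart p \o chart_inv q) (chart q q)).
    by rewrite E.
  have := derive_comp w (transition_diff qq pq) dPsi'; rewrite E.
  have -> : 'D_w (chart p \o chart_inv q) (chart q q) = u by exact: transferK.
  move=> <-; apply: near_eq_derive.
  have nf1 : \forall r \near q, dom (f p) (f r) by apply: (cf q); exact: dom_near.
  have nf2 : \forall r \near q, dom (f q) (f r) by apply: (cf q); exact: dom_near.
  have nall : \forall r \near q, [/\ V r = coord_field (f p) (phi (chart p r)) (f r),
     dom (f p) (f r), dom (f q) (f r) & dom p r].
    by near=> r; split; near: r => //; exact: dom_near.
  apply: filterS (chart_inv_near qq nall) => y [VEy fpr fqr pr] /=; rewrite VEy.
  apply: etrans (transfer_trans _ fpr (dom_mem _) fqr) _.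
  by rewrite /Psi /F /= map_rep_chart.
have VqE : V q = coord_field (f p) (phi x) (f q) := nbhs_singleton VE.
have tw : tangent_map f q w = coord_field (f p) a (f q) := tangent_map_coord u pq fpq.
have T2 : DN (f q) (tangent_map f q w) (coord_field (f q) (V q)) =
    coord_field (f p) (christoffel DN (f p) a (phi x) (chart (f p) (f q))) (f q)
    - 'D_a ('D_(phi x) tau) (F x).
  rewrite VqE tw; apply: etrans (cov_chart_change DN a (phi x) fpq) _.
  by rewrite -(christoffelE DN a (phi x) fpq) /F /x (map_rep_chart pq).
have lc := linD (coord_field_linear fpq).
rewrite /cov_along; rewrite T1 T2 DPsi [RHS]lc.
have cancel (A B C : 'rV[R]_e) : A + B + (C - A) = B + C.
  by apply/rowP => i; rewrite !mxE; ring.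
exact: cancel.
Unshelve. all: by end_near. Qed.

Variables (DN : connection N) (D : connection M).
Hypothesis no_second_form : forall p X Y,
  smooth_field_at p X -> smooth_field_at p Y -> second_form f DN D X Y p = 0.

Lemma near_source p : \forall x \near chart p p,
  exists q, [/\ x = chart p q, dom p q & dom (f p) (f q)].
Proof.
have pp := dom_mem p; have [cf _] := f_smooth.
have nf : \forall r \near p, dom (f p) (f r).
  by apply: (cf p); apply: dom_near; exact: dom_mem.
apply: filterS2 (codom_near pp) (chart_inv_near pp nf) => x [px xE] fpx.
by exists (chart_inv p x).
Qed.

(** The equation h = 0 for coordinate fields, at all points near p and in
    the fixed charts around p and f p. *)
Lemma gauss_formula p : \forall x \near chart p p, forall u v,
  'D_u ('D_v (map_rep f p)) x
  + christoffel DN (f p) ('D_u (map_rep f p) x) ('D_v (map_rep f p) x)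
      (map_rep f p x)
  = 'D_(christoffel D p u v x) (map_rep f p) x.
Proof.
apply: filterS (near_source p) => _ [q [-> pq fpq]] u v.
have [cf sf] := f_smooth.
have su := coord_field_smooth u pq; have sv := coord_field_smooth v pq.
apply: (coord_field_inj fpq); rewrite (map_rep_chart pq).
have sphi := smooth_near_derive v (map_rep_near pq fpq).
have VE : \forall r \near q, pushforward f (coord_field p v) r =
    coord_field (f p) ('D_v (map_rep f p) (chart p r)) (f r).
  have nf : \forall r \near q, dom (f p) (f r) by apply: (cf q); exact: dom_near.
  apply: filterS2 (dom_near pq) nf => r pr fpr.
  exact: tangent_map_coord.
apply: etrans (esym (cov_along_coord DN u pq fpq sphi VE)) _.
apply: etrans (subr0_eq (no_second_form su sv)) _.
rewrite /nab -(christoffelE D u v pq); exact: tangent_map_coord.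
Qed.

End Gauss.

Section GaussEquation.
Context {R : realType} {d e : nat} {M : manifold R d} {N : manifold R e}.
Variables (f : M -> N) (f_smooth : smooth_map f).
Variables (DN : connection N) (D : connection M).
Hypothesis no_second_form : forall p X Y,
  smooth_field_at p X -> smooth_field_at p Y -> second_form f DN D X Y p = 0.

(** The derivative of [gauss_formula] at p in the direction w. *)
Lemma gauss_formula_derive p w u v :
  let F := map_rep f p in let x := chart p p in
  let G := christoffel DN (f p) in
  'D_w ('D_u ('D_v F)) x
  + ('D_('D_w F x) (G ('D_u F x) ('D_v F x)) (F x)
     + G ('D_w ('D_u F) x) ('D_v F x) (F x)
     + G ('D_u F x) ('D_w ('D_v F) x) (F x))
  = 'D_w ('D_(christoffel D p u v x) F) x
    + 'D_('D_w (christoffel D p u v) x) F x :> 'rV[R]_e.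
Proof.
move=> F x G; have pp := dom_mem p; have fpp := dom_mem (f p).
have sF : smooth_near F x := map_rep_near f_smooth pp fpp.
have dF := smooth_near_differentiable sF.
have Fx : F x = chart (f p) (f p) := map_rep_chart f pp.
have cF := differentiable_continuous dF.
have nG : \forall y \near x, dom (f p) (chart_inv (f p) (F y)).
  have nc : \forall z \near F x, dom (f p) (chart_inv (f p) z).
    by rewrite Fx; exact: near_codom.
  exact: cF _ nc.
have dGF a b : differentiable (fun y => G a b (F y)) x.
  apply: (@differentiable_comp _ _ _ _ F (G a b) _ dF).
  by rewrite Fx; exact: christoffel_diff.
have DGF a b : 'D_w (fun y => G a b (F y)) x = 'D_('D_w F x) (G a b) (F x).
  apply: (@derive_comp _ _ _ _ F (G a b) x w dF).
  by rewrite Fx; exact: christoffel_diff.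
have dDF c : differentiable ('D_c F) x.
  by apply: smooth_near_differentiable; exact: smooth_near_derive.
have lG1 b : \forall y \near x, linear (fun a => G a b (F y)).
  by apply: filterS nG => y; exact: christoffel_linearl.
have dG1 b : differentiable (fun y => G ('D_u F y) b (F y)) x.
  exact: (@differentiable_linfam _ _ _ _ (fun y a => G a b (F y)) ('D_u F) x
    (lG1 b) (fun a => dGF a b) (dDF u)).
have DG1 b : 'D_w (fun y => G ('D_u F y) b (F y)) x =
    'D_('D_w F x) (G ('D_u F x) b) (F x) + G ('D_w ('D_u F) x) b (F x).
  rewrite -[in RHS]DGF.
  exact: (@derive_linfam _ _ _ _ (fun y a => G a b (F y)) ('D_u F) x w
    (lG1 b) (fun a => dGF a b) (dDF u)).
have lG2 : \forall y \near x, linear (fun b => G ('D_u F y) b (F y)).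
  by apply: filterS nG => y; exact: christoffel_linearr.
have dG2 : differentiable (fun y => G ('D_u F y) ('D_v F y) (F y)) x.
  exact: (@differentiable_linfam _ _ _ _ (fun y b => G ('D_u F y) b (F y))
    ('D_v F) x lG2 dG1 (dDF v)).
have DG2 : 'D_w (fun y => G ('D_u F y) ('D_v F y) (F y)) x =
    'D_('D_w F x) (G ('D_u F x) ('D_v F x)) (F x)
     + G ('D_w ('D_u F) x) ('D_v F x) (F x)
     + G ('D_u F x) ('D_w ('D_v F) x) (F x).
  rewrite -[in RHS]DG1.
  exact: (@derive_linfam _ _ _ _ (fun y b => G ('D_u F y) b (F y))
    ('D_v F) x w lG2 dG1 (dDF v)).
have dDDF : differentiable ('D_u ('D_v F)) x.
  apply: smooth_near_differentiable; apply: smooth_near_derive.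
  exact: smooth_near_derive.
have lhsE := deriveD (diff_derivable dDDF) (diff_derivable dG2) (v := w).
have lF : \forall y \near x, linear (fun c => 'D_c F y).
  apply: filterS (smooth_near_near sF) => y sy k a b.
  by apply: derive_addv; exact: smooth_near_differentiable.
have rhsE := derive_linfam w lF dDF (christoffel_diff D p u v).
rewrite -DG2; apply: etrans (esym lhsE) (etrans _ rhsE).
apply: near_eq_derive.
by apply: filterS (gauss_formula f_smooth no_second_form p) => y hy; exact: (hy u v).
Qed.

(** Subtract from [gauss_formula_derive] the same equation with u and w
    exchanged.  The third derivatives of F and the term in which the first
    argument of the Christoffel symbol is differentiated are symmetric in u
    and w and cancel.  Replacing the remaining second derivatives of F by
    [gauss_formula] leaves the two curvatures and some mixed terms, which
    cancel in pairs. *)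
Lemma gauss_riemann p w u v :
  tangent_map f p (riemann D p w u v) =
  riemann DN (f p) (tangent_map f p w) (tangent_map f p u) (tangent_map f p v).
Proof.
have pp := dom_mem p; have fpp := dom_mem (f p).
pose F := map_rep f p; pose x := chart p p; pose G := christoffel DN (f p).
pose H := christoffel D p.
have sF : smooth_near F x := map_rep_near f_smooth pp fpp.
have dF := smooth_near_differentiable sF.
have Fx : F x = chart (f p) (f p) := map_rep_chart f pp.
have gx : forall u v, 'D_u ('D_v F) x = 'D_(H u v x) F x - G ('D_u F x) ('D_v F x) (F x).
  move=> a b; have := nbhs_singleton (gauss_formula f_smooth no_second_form p).
  by move=> /(_ a b) <-; rewrite addrK.
have sDF v' : smooth_near ('D_v' F) x by exact: smooth_near_derive.
have ldf : linear (fun a => 'D_a F x : 'rV[R]_e).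
  by move=> k a b; apply: derive_addv.
have fxp : dom (f p) (chart_inv (f p) (F x)) by rewrite Fx chartK.
have lG a := christoffel_linearr DN a fxp.
pose df a : 'rV[R]_e := 'D_a F x.
pose E w' u' : 'rV[R]_e := G ('D_w' F x) (df (H u' v x)) (F x).
pose Q w' u' : 'rV[R]_e := G ('D_w' F x) (G ('D_u' F x) ('D_v F x) (F x)) (F x).
pose P w' u' : 'rV[R]_e := 'D_('D_w' F x) (G ('D_u' F x) ('D_v F x)) (F x).
pose T w' u' : 'rV[R]_e := 'D_w' ('D_u' ('D_v F)) x.
pose S w' u' : 'rV[R]_e := G ('D_w' ('D_u' F) x) ('D_v F x) (F x).
have eqn w' u' : T w' u' + (P w' u' + S w' u' + (E u' w' - Q u' w')) =
    (df (H w' (H u' v x) x) - E w' u') + df ('D_w' (H u' v) x).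
  have GS : G ('D_u' F x) ('D_w' ('D_v F) x) (F x) = E u' w' - Q u' w'.
    rewrite gx; exact: (linB (lG ('D_u' F x))).
  have DS : 'D_w' ('D_(H u' v x) F) x = df (H w' (H u' v x) x) - E w' u'.
    exact: gx.
  by rewrite -GS -DS; exact: gauss_formula_derive.
have Tsym : T u w = T w u by exact: smooth_near_schwarz.
have Ssym : S u w = S w u.
  exact: (f_equal (fun z => G z ('D_v F x) (F x)) (smooth_near_schwarz u w sF)).
have combine (t s p1 p2 e1 e2 q1 q2 h1 h2 d1 d2 : 'rV[R]_e) :
    t + (p1 + s + (e2 - q2)) = (h1 - e1) + d1 ->
    t + (p2 + s + (e1 - q1)) = (h2 - e2) + d2 ->
    d1 - d2 + h1 - h2 = p1 - p2 + q1 - q2.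
  move=> /rowP eq1 /rowP eq2; apply/rowP => i.
  by move: (eq1 i) (eq2 i); rewrite !mxE => ? ?; lra.
have eq1 := eqn w u; have := eqn u w; rewrite Tsym Ssym => eq2.
rewrite -[LHS]/(df (riemann D p w u v)).
have -> : df (riemann D p w u v) = df ('D_w (H u v) x) - df ('D_u (H w v) x)
    + df (H w (H u v x) x) - df (H u (H w v x) x).
  by rewrite /df -(linB ldf) -(linD ldf) -(linB ldf).
apply: etrans (combine _ _ _ _ _ _ _ _ _ _ _ _ eq1 eq2) _.
by rewrite /P /Q Fx.
Qed.

End GaussEquation.

Section GaussScurv.
Context {R : realType} {d e : nat} {M : manifold R d} {N : manifold R e}.

Lemma gauss_Scurv (f : M -> N) (DN DNs : connection N)
    (D Ds : connection M) p w u v :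
  smooth_map f -> doubly_autoparallel f DN DNs D Ds ->
  tangent_map f p (Scurv D Ds p w u v) =
  Scurv DN DNs (f p) (tangent_map f p w) (tangent_map f p u) (tangent_map f p v).
Proof.
move=> sf auto.
have h0 q X Y : smooth_field_at q X -> smooth_field_at q Y ->
  second_form f DN D X Y q = 0 by move=> sX sY; have [] := auto q X Y sX sY.
have hs0 q X Y : smooth_field_at q X -> smooth_field_at q Y ->
  second_form f DNs Ds X Y q = 0 by move=> sX sY; have [] := auto q X Y sX sY.
have dF := smooth_near_differentiable
  (map_rep_near sf (dom_mem p) (dom_mem (f p))).
have lf : linear (tangent_map f p).
  by move=> k a b; apply: derive_addv.
rewrite !Scurv_riemann (linZ lf) (linD lf); congr (_ *: _).
by congr (_ + _); exact: gauss_riemann.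
Qed.

End GaussScurv.

(** * Traces of Bochner type tensors *)

Section Trace.
Context {R : realType} {d : nat}.
Implicit Types (T : 'rV[R]_d -> 'rV[R]_d) (u v w : 'rV[R]_d).

Lemma traceE T : trace T = \sum_i T (delta_mx 0 i) 0 i.
Proof. by rewrite /trace /mxtrace; apply: eq_bigr => i _; rewrite mxE. Qed.

Lemma traceZ k T : trace (fun u => k *: T u) = k * trace T.
Proof. by rewrite !traceE mulr_sumr; apply: eq_bigr => i _; rewrite mxE. Qed.


Lemma trace_id : trace (id : 'rV[R]_d -> 'rV[R]_d) = d%:R.
Proof.
rewrite traceE (eq_bigr (fun=> 1)) => [|i _]; last by rewrite /= mxE !eqxx.
by rewrite sumr_const card_ord.
Qed.

Lemma traceD T T' : trace (fun u => T u + T' u) = trace T + trace T'.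
Proof. by rewrite !traceE -big_split; apply: eq_bigr => i _; rewrite mxE. Qed.

Lemma traceN T : trace (fun u => - T u) = - trace T.
Proof. by rewrite !traceE -sumrN; apply: eq_bigr => i _; rewrite mxE. Qed.

Lemma trace_rank1 (al : 'rV[R]_d -> R) w :
  (forall k u v, al (k *: u + v) = k * al u + al v) ->
  trace (fun u => al u *: w) = al w.
Proof.
move=> lal; have al0 : al 0 = 0.
  have := lal 1 0 0; rewrite scale1r addr0 mul1r => /eqP.
  by rewrite -subr_eq0 opprD addrA subrr sub0r oppr_eq0 => /eqP.
rewrite traceE [in RHS](row_sum_delta w).
have alS (s : seq 'I_d) : al (\sum_(i <- s) w 0 i *: delta_mx 0 i) =
    \sum_(i <- s) w 0 i * al (delta_mx 0 i).
  by elim: s => [|i s IH]; rewrite ?big_nil ?al0// !big_cons lal IH.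
by rewrite alS; apply: eq_bigr => i _; rewrite mxE mulrC.
Qed.

Lemma mul_rV_lin T u : linear T -> u *m lin1_mx T = T u.
Proof.
move=> lT; rewrite [RHS](linfam_sum _ lT); apply/rowP => j.
rewrite mxE summxE; apply: eq_bigr => i _.
by rewrite !mxE.
Qed.

End Trace.

Section Hermitian.
Context {R : realType} {d : nat} (M : manifold R d) (g : metric M) (p : M).
Variable J : 'rV[R]_d -> 'rV[R]_d.
Hypothesis J_linear : linear J.
Hypothesis JJ : forall u, J (J u) = - u.
Hypothesis J_skew : forall u v, g p (J u) v = - g p u (J v).
Implicit Types (L Q T : 'rV[R]_d -> 'rV[R]_d) (u v w : 'rV[R]_d).

Lemma metricDl u v w : g p (u + v) w = g p u w + g p v w.
Proof. by rewrite -[u]scale1r metric_linear mul1r scale1r. Qed.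

Lemma metric0l w : g p 0 w = 0.
Proof.
have /eqP := metricDl 0 0 w.
by rewrite addr0 -subr_eq0 opprD addrA subrr sub0r oppr_eq0 => /eqP.
Qed.

Lemma metricZl k u w : g p (k *: u) w = k * g p u w.
Proof. by rewrite -[k *: u]addr0 metric_linear metric0l addr0. Qed.

Lemma metricNl u w : g p (- u) w = - g p u w.
Proof. by rewrite -scaleN1r metricZl mulN1r. Qed.

Lemma metric_inj u v : (forall w, g p u w = g p v w) -> u = v.
Proof.
move=> uv; apply/eqP; rewrite -subr_eq0; apply: contraT => /(metric_gt0 g p).
by rewrite metricDl metricNl uv subrr ltxx.
Qed.

Lemma metricZr k u w : g p u (k *: w) = k * g p u w.
Proof. by rewrite Defs.metric_sym metricZl Defs.metric_sym. Qed.

Lemma metricDr u v w : g p u (v + w) = g p u v + g p u w.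
Proof. by rewrite Defs.metric_sym metricDl !(Defs.metric_sym _ _ u). Qed.

Lemma metricNr u w : g p u (- w) = - g p u w.
Proof. by rewrite Defs.metric_sym metricNl Defs.metric_sym. Qed.

(** In terms of matrices, T is conjugate by the Gram matrix to the transpose
    of its adjoint. *)
Lemma trace_adjoint T T' : linear T -> linear T' ->
  (forall u v, g p (T u) v = g p u (T' v)) -> trace T = trace T'.
Proof.
move=> lT lT' adj; rewrite /trace; set A := lin1_mx T; set A' := lin1_mx T'.
have AG : A *m gram g p = gram g p *m A'^T.
  apply/matrixP => i j.
  have entry (B : 'M[R]_d) : B i j =
      ((delta_mx 0 i : 'rV_d) *m B *m (delta_mx 0 j : 'rV_d)^T) 0 0.
    by rewrite -rowE trmx_delta -colE !mxE.
  rewrite [LHS]entry [RHS]entry !mulmxA (mul_rV_lin _ lT) -metricE adj.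
  by rewrite metricE -(mul_rV_lin _ lT') trmx_mul !mulmxA.
rewrite -[A](mulmxK (gram_unit g p)) AG mxtrace_mulC mulmxA.
by rewrite mulVmx ?gram_unit// mul1mx mxtrace_tr.
Qed.

Lemma trace_skew T : linear T ->
  (forall u v, g p (T u) v = - g p u (T v)) -> trace T = 0.
Proof.
move=> lT sT; have lN : linear (fun u => - T u).
  by move=> k u v; rewrite lT opprD scalerN.
have := trace_adjoint lT lN (fun u v => etrans (sT u v) (esym (metricNr _ _))).
by rewrite traceN => /eqP; rewrite -addr_eq0 -mulr2n mulrn_eq0 => /eqP.
Qed.

(** The first brace of the Bochner formula, with an arbitrary operator L in
    the place of the Ricci operator. *)
Definition bochner_brace L u v w : 'rV[R]_d :=
  g p v w *: L u - g p (L u) w *: v + g p (L v) w *: u - g p u w *: L v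
  + g p (J v) w *: L (J u) - g p (L (J u)) w *: J v
  + g p (L (J v)) w *: J u - g p (J u) w *: L (J v)
  - (2 * g p (J u) (L v)) *: J w - (2 * g p (J u) v) *: L (J w).

(** The curvature tensor of a complex space form of holomorphic sectional
    curvature 4. *)
Definition holomorphic_brace u v w : 'rV[R]_d :=
  g p v w *: u - g p u w *: v + g p (J v) w *: J u - g p (J u) w *: J v
  - (2 * g p (J u) v) *: J w.

(** For the identity operator, the terms of the brace coincide in pairs. *)
Lemma bochner_brace_affine Q al be u v w :
  bochner_brace (fun x => al *: Q x + be *: x) u v w =
  al *: bochner_brace Q u v w + (2 * be) *: holomorphic_brace u v w.
Proof.
rewrite /bochner_brace !metricDl !metricDr !metricZl !metricZr.
by apply/rowP => i; rewrite !mxE; ring.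
Qed.

(** Stated for every linear L, because the symmetry of L is deduced from
    this formula in [bochner_flat_ricci]. *)
Lemma trace_bochner_brace L v w : linear L ->
  trace (fun u => bochner_brace L u v w) =
  trace L * g p v w + (d%:R + 1) * g p (L v) w
  + trace (fun u => L (J u)) * g p (J v) w
  + g p (L (J v)) (J w) + 2 * g p (L (J w)) (J v).
Proof.
move=> lL; have lLJ := lin_comp J_linear lL.
have tJ : trace J = 0 := trace_skew J_linear J_skew.
have lg (T : 'rV[R]_d -> 'rV[R]_d) x : linear T ->
    forall k a b, g p (T (k *: a + b)) x = k * g p (T a) x + g p (T b) x.
  by move=> lT k a b; rewrite lT metric_linear.
have lid : linear (id : 'rV[R]_d -> 'rV[R]_d) by [].
have t2 : trace (fun u => g p (L u) w *: v) = g p (L v) w.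
  exact: trace_rank1 (lg L w lL).
have t4 : trace (fun u => g p u w *: L v) = g p (L v) w.
  exact: trace_rank1 (lg id w lid).
have t6 : trace (fun u => g p (L (J u)) w *: J v) = - g p (L v) w.
  by rewrite (trace_rank1 _ (lg _ w lLJ)) JJ (linN lL) metricNl.
have t8 : trace (fun u => g p (J u) w *: L (J v)) = - g p (L (J v)) (J w).
  by rewrite (trace_rank1 _ (lg _ w J_linear)) J_skew.
have lg2 x : forall k a b,
    2 * g p (J (k *: a + b)) x = k * (2 * g p (J a) x) + 2 * g p (J b) x.
  by move=> k a b; rewrite J_linear metric_linear; ring.
have t9 : trace (fun u => (2 * g p (J u) (L v)) *: J w) = - (2 * g p (L v) w).
  by rewrite (trace_rank1 _ (lg2 _)) JJ metricNl Defs.metric_sym mulrN.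
have t10 : trace (fun u => (2 * g p (J u) v) *: L (J w)) =
    - (2 * g p (L (J w)) (J v)).
  by rewrite (trace_rank1 _ (lg2 _)) J_skew mulrN.
rewrite /bochner_brace !(traceD, traceN) !traceZ.
rewrite t2 t4 t6 t8 t9 t10 tJ trace_id; ring.
Qed.

Lemma trace_holomorphic_brace v w :
  trace (fun u => holomorphic_brace u v w) = (d%:R + 2) * g p v w.
Proof.
have lid : linear (id : 'rV[R]_d -> 'rV[R]_d) by [].
have E u : holomorphic_brace u v w = 2^-1 *: bochner_brace id u v w.
  have := bochner_brace_affine id 0 1 u v w.
  have -> : (fun x : 'rV[R]_d => 0 *: id x + 1 *: x) = id.
    by apply/funext => x; rewrite scale0r add0r scale1r.
  by move=> ->; rewrite scale0r add0r mulr1 scalerA mulVf ?pnatr_eq0// scale1r.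
have -> : (fun u => holomorphic_brace u v w) =
    (fun u => 2^-1 *: bochner_brace id u v w) by apply/funext.
rewrite traceZ trace_bochner_brace// trace_id (trace_skew J_linear J_skew).
rewrite (Defs.metric_sym _ _ (J w)) /= [g p (J v) (J w)]J_skew JJ metricNr.
by field.
Qed.

(** Write A(v, w) = g(L v, w) and t = tr (L J).  The trace of the
    hypothesis on S reads
    3 A(v, w) = t g(J v, w) + A(J v, J w) + 2 A(J w, J v).
    The instances at (v, w), (w, v), (J v, J w) and (J w, J v) form a linear
    system, which gives A(J v, J w) = A(v, w) and
    2 (A(v, w) - A(w, v)) = t g(J v, w).  By the former L commutes with J; by
    the latter the adjoint of L J is - (L J + t / 2), whose trace is
    - (t + t d / 2), so that t = 0 and A is symmetric. *)
Lemma bochner_flat_ricci L (S : 'rV[R]_d -> 'rV[R]_d -> 'rV[R]_d -> 'rV[R]_d) :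
  linear L ->
  (forall u v w, S u v w = (d%:R + 4)^-1 *: bochner_brace L u v w
    - (trace L / ((d%:R + 4) * (d%:R + 2))) *: holomorphic_brace u v w) ->
  (forall v w, g p (L v) w = trace (fun u => S u v w)) ->
  (forall u v, g p (L u) v = g p u (L v)) /\ (forall u, L (J u) = J (L u)).
Proof.
move=> lL SE LE; pose t := trace (fun u => L (J u)).
have d0 : 0 <= d%:R :> R by exact: ler0n.
have key v w : 3 * g p (L v) w =
    t * g p (J v) w + g p (L (J v)) (J w) + 2 * g p (L (J w)) (J v).
  have := LE v w.
  have -> : (fun u => S u v w) = (fun u => (d%:R + 4)^-1 *: bochner_brace L u v w
    - (trace L / ((d%:R + 4) * (d%:R + 2))) *: holomorphic_brace u v w).
    by apply/funext => u.
  rewrite traceD traceN !traceZ trace_bochner_brace// trace_holomorphic_brace.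
  rewrite -/t => E.
  have d4 : d%:R + 4 != 0 :> R by apply: lt0r_neq0; lra.
  have d2 : d%:R + 2 != 0 :> R by apply: lt0r_neq0; lra.
  have : (d%:R + 4) * g p (L v) w = (d%:R + 1) * g p (L v) w +
     (t * g p (J v) w + g p (L (J v)) (J w) + 2 * g p (L (J w)) (J v)).
    by rewrite {1}E; field; rewrite d4 d2.
  by move=> ?; lra.
(* the solution of the linear system *)
have keys v w :
    g p (L v) w = g p (L (J v)) (J w) /\
    2 * (g p (L v) w - g p (L w) v) = t * g p (J v) w.
  have e1 := key v w; have e2 := key w v.
  have e3 := key (J v) (J w); have e4 := key (J w) (J v).
  have s1 : g p (J w) v = - g p (J v) w by rewrite J_skew Defs.metric_sym.
  rewrite s1 in e2.
  rewrite !JJ !(linN lL) !metricNl !metricNr !opprK in e3 e4.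
  rewrite (_ : g p v (J w) = - g p (J v) w) in e3; last by rewrite J_skew opprK.
  rewrite (_ : g p w (J v) = g p (J v) w) in e4; last by rewrite Defs.metric_sym.
  by split; lra.
have LJ u : L (J u) = J (L u).
  apply: metric_inj => w; rewrite J_skew.
  have [-> _] := keys u (J w).
  by rewrite JJ metricNr opprK.
have t0 : t = 0.
  have lLJ := lin_comp J_linear lL.
  have lA : linear (fun u => - (L (J u) + (t / 2) *: u)).
    by move=> k u v; rewrite lLJ; apply/rowP => i; rewrite !mxE; ring.
  have adj u v : g p (L (J u)) v = g p u (- (L (J v) + (t / 2) *: v)).
    rewrite metricNr metricDr metricZr.
    have [_] := keys (J u) v; rewrite JJ metricNl => e.
    have e' : g p (L v) (J u) = - g p u (L (J v)).
      by rewrite Defs.metric_sym J_skew LJ.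
    by rewrite e' in e; lra.
  have := trace_adjoint lLJ lA adj.
  rewrite traceN traceD traceZ trace_id -/t => e.
  have : t * (2 + d%:R / 2) = 0 by lra.
  by move=> /eqP; rewrite mulf_eq0 => /orP[/eqP//|/eqP ?]; lra.
split=> // u v; have [_] := keys u v; rewrite t0 mul0r [g p (L v) u]Defs.metric_sym.
by move=> ?; lra.
Qed.

(** Since tr (Q J) = 0, the trace of S shows that L = al Q + be id with
    al = c (d + 4) and be = c tr Q - a (d + 2).  Then the brace of L cancels
    the brace of Q, and the scalar curvature term cancels the multiples of
    the space form tensor. *)
Lemma bochner_of_brace Q L S c a :
  linear Q -> (forall u v, g p (Q u) v = g p u (Q v)) ->
  (forall u, Q (J u) = J (Q u)) ->
  (forall u v w, S u v w = c *: bochner_brace Q u v w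
    - a *: holomorphic_brace u v w) ->
  (forall v w, g p (L v) w = trace (fun u => S u v w)) ->
  forall u v w, S u v w - (d%:R + 4)^-1 *: bochner_brace L u v w
    + (trace L / ((d%:R + 4) * (d%:R + 2))) *: holomorphic_brace u v w = 0.
Proof.
move=> lQ symQ QJ SE LE u v w.
have d0 : 0 <= d%:R :> R by exact: ler0n.
have d4 : d%:R + 4 != 0 :> R by apply: lt0r_neq0; lra.
have d2 : d%:R + 2 != 0 :> R by apply: lt0r_neq0; lra.
have lQJ := lin_comp J_linear lQ.
have tQJ : trace (fun u => Q (J u)) = 0.
  apply: trace_skew lQJ _ => x y.
  by rewrite symQ J_skew QJ.
pose al := c * (d%:R + 4); pose be := c * trace Q - a * (d%:R + 2).
have LQ : L = (fun x => al *: Q x + be *: x).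
  apply/funext => x; apply: metric_inj => y.
  rewrite LE; have -> : (fun u => S u x y) = (fun u => c *: bochner_brace Q u x y
      - a *: holomorphic_brace u x y) by apply/funext.
  rewrite traceD traceN !traceZ trace_bochner_brace// trace_holomorphic_brace.
  rewrite tQJ metricDl !metricZl !QJ !J_skew !JJ !metricNr.
  by rewrite (Defs.metric_sym _ _ (Q y)) -symQ /al /be; ring.
have tL : trace L = al * trace Q + be * d%:R.
  by rewrite LQ traceD !traceZ trace_id.
rewrite tL LQ bochner_brace_affine SE /al /be.
move: (bochner_brace Q u v w) (holomorphic_brace u v w) => B H.
by apply/rowP => i; rewrite !mxE; field; rewrite d4 d2.
Qed.

End Hermitian.

(** * The Bochner tensor of the submanifold *)

Section BochnerTensor.
Context {R : realType} {d : nat} (M : manifold R d).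
Variables (g : metric M) (D Ds : connection M) (J : almost_complex M).

Lemma bochnerE (p : M) u v w : bochner g D Ds J p u v w =
  Scurv D Ds p u v w
  - (d%:R + 4)^-1 *: bochner_brace g p (J p) (ricci_op g D Ds p) u v w
  + (trace (ricci_op g D Ds p) / ((d%:R + 4) * (d%:R + 2)))
    *: holomorphic_brace g p (J p) u v w.
Proof. by rewrite /bochner /scalar_curv !natrD. Qed.

Lemma metric_sharp (p : M) (al : 'rV[R]_d -> R) w :
  (forall k u v, al (k *: u + v) = k * al u + al v) ->
  g p (sharp g p al) w = al w.
Proof.
move=> lal.
pose h := GRing.isLinear.Build _ _ _ _ _ (lal : linear_for *%R al).
pose G : {linear 'rV[R]_d -> R | *%R} := HB.pack al h.
exact: (sharpP g p G w).
Qed.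

Lemma ricci_opP (p : M) v w :
  g p (ricci_op g D Ds p v) w = trace (fun u => Scurv D Ds p u v w).
Proof.
apply: (metric_sharp p (al := ricci D Ds p v)) => k a b.
rewrite /ricci -traceZ -traceD; apply: congr1; apply/funext => u.
exact: Scurv_linear3.
Qed.

Lemma ricci_op_linear (p : M) : linear (ricci_op g D Ds p).
Proof.
move=> k a b; apply: (@metric_inj _ _ _ g p) => w.
apply: etrans (ricci_opP p _ w) _; rewrite [RHS]metric_linear.
rewrite [X in _ = _ * X + _](ricci_opP p a w) [X in _ = _ + X](ricci_opP p b w).
rewrite -traceZ -traceD; apply: congr1; apply/funext => u.
exact: Scurv_linear2.
Qed.

Hypothesis omega_skew : forall p u v, omega g J p u v = - omega g J p v u.

Lemma complex_skew (p : M) u v : g p (J p u) v = - g p u (J p v).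
Proof.
have := omega_skew p u v; rewrite /omega (Defs.metric_sym _ _ v) => ->.
by rewrite opprK.
Qed.

End BochnerTensor.

Theorem theorem1p2 (R : realType) (m n : nat)
  (N : manifold R (2 * m)) (gN : metric N) (nablaN nablaNs : connection N)
  (JN : almost_complex N)
  (M : manifold R (2 * n)) (f : M -> N)
  (g : metric M) (nabla nablas : connection M) (J : almost_complex M)
  (N_holo : holomorphic_statistical gN nablaN JN)
  (N_dual : dual_connections gN nablaN nablaNs)
  (f_imm : immersion f)
  (f_holo : holomorphic_submanifold f JN)
  (g_induced : isometric f gN g)
  (nabla_induced : induced_connection f gN nablaN nabla)
  (nablas_induced : induced_connection f gN nablaNs nablas)
  (J_induced : induced_complex f JN J)
  (f_auto : doubly_autoparallel f nablaN nablaNs nabla nablas)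
  (N_flat : bochner_flat gN nablaN nablaNs JN) :
  bochner_flat g nabla nablas J.
Proof.
move=> p X Y Z; have [f_smooth _] := f_imm; have [_ skewN _] := N_holo.
pose df := tangent_map f p.
have lf : linear df.
  move=> k a b; apply: derive_addv; apply: smooth_near_differentiable.
  exact: (map_rep_near f_smooth (dom_mem p) (dom_mem (f p))).
have gdf u v : g p u v = gN (f p) (df u) (df v) by exact: g_induced.
have Jdf u : df (J p u) = JN (f p) (df u) by exact: J_induced.
have Sdf u v w : df (Scurv nabla nablas p u v w) =
    Scurv nablaN nablaNs (f p) (df u) (df v) (df w).
  by exact: gauss_Scurv.
have lJN : linear (JN (f p)) by move=> k a b; exact: complex_linear.
have lJ : linear (J p) by move=> k a b; exact: complex_linear.
have JJ u : J p (J p u) = - u by exact: complex_square.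
have JJN u : JN (f p) (JN (f p) u) = - u by exact: complex_square.
have sJN u v : gN (f p) (JN (f p) u) v = - gN (f p) u (JN (f p) v).
  exact: complex_skew.
have sJ u v : g p (J p u) v = - g p u (J p v) by rewrite !gdf !Jdf sJN.
pose L := ricci_op gN nablaN nablaNs (f p).
have lL : linear L by exact: ricci_op_linear.
pose c : R := ((2 * m)%:R + 4)^-1.
pose a : R := trace L / (((2 * m)%:R + 4) * ((2 * m)%:R + 2)).
have SN u v w : Scurv nablaN nablaNs (f p) u v w =
    c *: bochner_brace gN (f p) (JN (f p)) L u v w
    - a *: holomorphic_brace gN (f p) (JN (f p)) u v w.
  have move_terms (A B C : 'rV[R]_(2 * m)) : A - B + C = 0 -> A = B - C.
    by move/eqP; rewrite -addrA addr_eq0 opprD opprK => /eqP.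
  apply: move_terms; apply: etrans (N_flat (f p) u v w).
  by rewrite bochnerE.
have [Lsym LJ] := bochner_flat_ricci lJN JJN sJN lL SN
  (ricci_opP gN nablaN nablaNs (f p)).
clearbody a c L df.
(* the compression of L to the tangent space of the submanifold *)
have [Q QE] : exists Q, forall u v, g p (Q u) v = gN (f p) (L (df u)) (df v).
  exists (fun u => sharp g p (fun v => gN (f p) (L (df u)) (df v))) => u v.
  by apply: metric_sharp => k x y; rewrite lf metricDr metricZr.
have lQ : linear Q.
  move=> k x y; apply: (@metric_inj _ _ _ g p) => w.
  apply: etrans (QE _ _) _; rewrite [RHS]metric_linear.
  rewrite [X in _ = _ * X + _]QE [X in _ = _ + X]QE.
  apply: etrans (f_equal (fun z => gN (f p) z (df w)) (lin_comp lf lL k x y)) _.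
  exact: metric_linear.
have Qsym u v : g p (Q u) v = g p u (Q v).
  by rewrite [RHS]Defs.metric_sym !QE Lsym Defs.metric_sym.
have QJ u : Q (J p u) = J p (Q u).
  apply: (@metric_inj _ _ _ g p) => w.
  by rewrite sJ !QE !Jdf LJ sJN.
have SM u v w : Scurv nabla nablas p u v w =
    c *: bochner_brace g p (J p) Q u v w - a *: holomorphic_brace g p (J p) u v w.
  apply: (@metric_inj _ _ _ g p) => x; rewrite gdf Sdf SN.
  have QEr y z : g p y (Q z) = gN (f p) (df y) (L (df z)).
    by rewrite Defs.metric_sym QE Defs.metric_sym.
  rewrite /bochner_brace /holomorphic_brace !(metricDl, metricNl, metricZl).
  by rewrite !QE !QEr !gdf !Jdf.
rewrite bochnerE.
exact: (bochner_of_brace lJ JJ sJ lQ Qsym QJ SM (ricci_opP g nabla nablas p)).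
Qed.
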